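(* Let $(J,K_1,K_2)$ be a triple with $J$ a compact Hausdorff space and $K_1$ and $K_2$ closed subspaces of $J$ whose union is $J$ and such that each of $J\setminus K_1$ and $J\setminus K_2$ contains a Cantor set. Then there exists a uniform algebra $A$ on $J$ such that $J$ has nontrivial $A$-rational hull, but each of $K_1$ and $K_2$ is $A$-convex and $\overline{A|K_j}=C(K_j)$ for $j=1,2$.
   Context: A Cantor set is any space homeomorphic to the usual middle-thirds Cantor set. For a compact Hausdorff space $X$, $C(X)$ is the algebra of all continuous complex-valued functions on $X$ with the supremum norm, and a uniform algebra on $X$ is a closed subalgebra of $C(X)$ that contains the constants and separates the points of $X$. For a uniform algebra $A$ on $X$, $\mathfrak{M}_A$ denotes its maximal ideal space, $\hat f$ the Gelfand transform of $f\in A$, and $X$ is regarded as a subset of $\mathfrak{M}_A$ via point evaluations. For a compact set $E\subset\mathfrak{M}_A$, the $A$-convex hull of $E$ is $\{\phi\in\mathfrak{M}_A:|\hat f(\phi)|\le\sup_E|\hat f|\text{ for all }f\in A\}$, and $E$ is $A$-convex if it equals its $A$-convex hull; the $A$-rational hull of $E$ is $\{\phi\in\mathfrak{M}_A:\hat f(\phi)\in\hat f(E)\text{ for all }f\in A\}$, and it is nontrivial if it is strictly larger than $E$. $A|K$ is the algebra of restrictions to $K$ of functions in $A$, and $\overline{A|K}$ is its uniform closure in $C(K)$. *)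

(* Defs.v *)
From mathcomp Require Import all_boot all_order all_algebra.
From mathcomp Require Import all_classical all_reals all_analysis.
From mathcomp Require Import complex.

Set Implicit Arguments.
Unset Strict Implicit.
Unset Printing Implicit Defensive.

Import Order.TTheory GRing.Theory Num.Theory.
Import numFieldNormedType.Exports.

Local Open Scope classical_set_scope.
Local Open Scope ring_scope.

Definition homeomorphic (X Y : topologicalType) : Prop :=
  exists (f : X -> Y) (g : Y -> X),
    [/\ continuous f, continuous g, cancel f g & cancel g f].

Section cantor_set.
Variable R : realType.

Definition remove_middle_third (S : set R) : set R :=
  [set x / 3 | x in S] `|` [set (x + 2) / 3 | x in S].

Definition middle_thirds_cantor_set : set R :=
  \bigcap_n iter n remove_middle_third `[0, 1]%classic.

Definition is_cantor_set (S : topologicalType) : Prop :=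
  homeomorphic S middle_thirds_cantor_set.

Definition contains_cantor_set (X : topologicalType) (U : set X) : Prop :=
  exists S : set X, S `<=` U /\ is_cantor_set S.

End cantor_set.

(* [R[i]^o] rather than [R[i]]: the regular algebra carries the topology and
   the uniform structure given by the norm of [R[i]]. *)
Notation Cplx R := (R[i]^o).

Section uniform_algebra.
Variable R : realType.
Local Notation C := (Cplx R).

(* Uniform limits of continuous functions being continuous, closedness for
   uniform convergence in [X -> C] and in the space of continuous functions
   agree, and likewise for closures. *)
Definition uclosure (X : choiceType) (A : set (X -> C)) : set (X -> C) :=
  closure (A : set {uniform X -> C}).

Definition continuous_functions (X : topologicalType) : set (X -> C) :=
  [set f | continuous f].

Record is_uniform_algebra (X : topologicalType) (A : set (X -> C)) : Prop := {
  ua_continuous : A `<=` @continuous_functions X;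
  ua_const : forall c : C, A (cst c);
  ua_add : forall f g, A f -> A g -> A (f + g);
  ua_scale : forall (c : C) f, A f -> A (c *: f);
  ua_mul : forall f g, A f -> A g -> A (f * g);
  ua_closed : closed (A : set {uniform X -> C});
  ua_separates : forall x y : X, x != y -> exists2 f, A f & f x != f y
}.

Section hulls.
Variables (X : topologicalType) (A : set (X -> C)).

(* The maximal ideal space, as the set of nonzero multiplicative linear
   functionals on [A].  The functionals are defined on the subtype of the
   elements of [A], on which the operations are those of [X -> C]. *)
Definition max_ideal_space : set (A -> C) :=
  [set phi |
    [/\ exists f, phi f != 0,
        forall f g h : A, \val h = \val f + \val g -> phi h = phi f + phi g,
        forall (c : C) (f h : A), \val h = c *: \val f -> phi h = c * phi f &
        forall f g h : A, \val h = \val f * \val g -> phi h = phi f * phi g]].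

Definition gelfand (f : A) (phi : A -> C) : C := phi f.

Definition point_eval (x : X) : A -> C := fun f => \val f x.

Definition modulus (z : C) : R := complex.Re `|z|.

(* The supremum is that of a bounded set when [E] consists of points of the
   maximal ideal space, since those are functionals of norm 1. *)
Definition A_convex_hull (E : set (A -> C)) : set (A -> C) :=
  [set phi | max_ideal_space phi /\
    forall f : A,
      modulus (gelfand f phi) <= sup [set modulus (gelfand f psi) | psi in E]].

Definition A_convex (E : set (A -> C)) : Prop := A_convex_hull E = E.

Definition A_rational_hull (E : set (A -> C)) : set (A -> C) :=
  [set phi | max_ideal_space phi /\
    forall f : A, (gelfand f @` E) (gelfand f phi)].

Definition has_nontrivial_A_rational_hull (E : set (A -> C)) : Prop :=
  E `<` A_rational_hull E.

Definition restriction_algebra (K : set X) : set (K -> C) :=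
  [set (fun x : K => f (\val x)) | f in A].

End hulls.

End uniform_algebra.

Arguments continuous_functions R X : clear implicits.
Arguments restriction_algebra {R X} A K.
Arguments max_ideal_space {R X} A.
Arguments point_eval {R X} A x f.

(* Main.v *)
Require Import Defs.
From mathcomp Require Import all_boot all_order all_algebra.
From mathcomp Require Import all_classical all_reals all_analysis.
From mathcomp Require Import complex cyclic separable cyclotomic.
From mathcomp Require Import ring lra.
Import Order.TTheory GRing.Theory Num.Theory.
Import numFieldNormedType.Exports.

(** Let E be a planar Cantor set carrying a measure whose Cauchy transform is continuous,
    and let A_E be the algebra of the continuous functions on the Riemann sphere that are
    holomorphic off E. Every value of such a function is taken on E. Indeed, if f is zero-free
    on E and vanishes at infinity, surround the small pieces of E by circles. On each of them
    f is nearly a nonzero constant, so it has winding number 0, and summing over the circles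
    f has no zero outside them, a contradiction. Hence all points of the sphere, and infinity
    in particular, belong to the rational hull of E, though they are not evaluations at points
    of E.

    Split E into two halves E_0 and E_1 of positive mass. Cauchy transforms of the
    mass near a point a of E_0 approximate 1 / (a - z) on E_1. The halves lie on two sides of a
    vertical line, so this function has real part of constant sign on E_1 and can be inverted
    in the closure of A_E on E_1: by the Neumann series, poles may be pushed along a line that
    the range avoids. So z is in the closure, and Newton's iteration for the square roots of 1
    separates, one digit after the other, the pieces of E_1 lying in different half-planes. The
    closure contains all step functions, so it is the algebra of all continuous functions.

    The Cantor sets outside K1 and outside K2 are disjoint, since K1 and K2 cover J. Their union
    L is identified with E so that K1 and K2 each meet L in one half. The algebra consists
    of the continuous functions on J whose restriction to L comes from A_E. Its restriction
    to K1 is dense: it is so on the half of L in K1, and the error made elsewhere on K1 is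
    removed by functions vanishing on L. Density implies convexity, since a character bounded
    by the supremum over K1 extends to all continuous functions on K1.

    The plane is used only through finite sums. The set E is coded by binary words, and A_E is
    replaced by the functions on L that are uniformly close, on the circles around the cells of
    each fine level, to rational functions with poles inside these circles ([approximable]).
    The winding argument becomes a comparison of the numbers of zeros and poles of such a
    rational function in each disc ([count_poles_le_zeros], [ratfun_not_near_nonzero]): if it
    vanishes at infinity, it has fewer zeros than poles. Convergence of the discretised Cauchy
    transforms is [cauchy_sum_step], the statement about values is [approximable_value],
    density on one half of L is [half_closure_continuous], and convexity is
    [dense_restriction_A_convex]. *)

Set Implicit Arguments.
Unset Strict Implicit.
Unset Printing Implicit Defensive.

Local Open Scope classical_set_scope.
Local Open Scope ring_scope.

(** * The modulus of a complex number *)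

Section modulus.
Variable R : realType.
Local Notation C := (Cplx R).
Implicit Types x y z w : C.

Lemma modulusE z : modulus z = Num.sqrt (complex.Re z ^+ 2 + complex.Im z ^+ 2).
Proof. by rewrite /modulus normc_def. Qed.

Lemma sqr_modulus z : modulus z ^+ 2 = complex.Re z ^+ 2 + complex.Im z ^+ 2.
Proof. by rewrite modulusE sqr_sqrtr // addr_ge0 // sqr_ge0. Qed.

Lemma normE z : `|z| = (modulus z)%:C%C.
Proof. by rewrite modulusE normc_def. Qed.

Lemma modulus_ge0 z : 0 <= modulus z.
Proof. by rewrite modulusE sqrtr_ge0. Qed.

Lemma modulusM z w : modulus (z * w) = modulus z * modulus w.
Proof. by apply: (@complexI R); rewrite rmorphM /= -!normE normrM. Qed.

Lemma modulus_triangle z w : modulus (z + w) <= modulus z + modulus w.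
Proof. by rewrite -lecR rmorphD /= -!normE ler_normD. Qed.

Lemma modulusN z : modulus (- z) = modulus z.
Proof. by rewrite /modulus normrN. Qed.

Lemma modulusB z w : modulus (z - w) = modulus (w - z).
Proof. by rewrite -modulusN opprB. Qed.

Lemma modulus_triangle3 x y z : modulus (x + (y + z)) <= modulus x + modulus y + modulus z.
Proof.
by have := modulus_triangle x (y + z); have := modulus_triangle y z; lra.
Qed.

Lemma modulus_triangle4 x y z w :
  modulus (x + (y + (z + w))) <= modulus x + modulus y + modulus z + modulus w.
Proof.
by have := modulus_triangle x (y + (z + w)); have := modulus_triangle3 y z w; lra.
Qed.

Lemma modulus_triangleB z w : modulus (z - w) <= modulus z + modulus w.
Proof. by rewrite (le_trans (modulus_triangle _ _)) // modulusN. Qed.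

Lemma modulus_dist z w u : modulus (z - u) <= modulus (z - w) + modulus (w - u).
Proof. by have := modulus_triangle (z - w) (w - u); rewrite addrA subrK. Qed.

Lemma modulus_lower z w : modulus z - modulus w <= modulus (z - w).
Proof. by rewrite lerBlDr; have := modulus_triangle (z - w) w; rewrite subrK. Qed.

Lemma modulus0 : modulus (0 : C) = 0.
Proof. by rewrite /modulus normr0. Qed.

Lemma modulus1 : modulus (1 : C) = 1.
Proof. by rewrite /modulus normr1. Qed.

Lemma modulus_eq0 z : (modulus z == 0) = (z == 0).
Proof. by rewrite -(inj_eq (@complexI R)) -normE normr_eq0. Qed.

Lemma modulus_gt0 z : (0 < modulus z) = (z != 0).
Proof. by rewrite lt_def modulus_eq0 modulus_ge0 andbT. Qed.

Lemma modulusV z : modulus z^-1 = (modulus z)^-1.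
Proof.
have [->|z0] := eqVneq z 0; first by rewrite invr0 modulus0 invr0.
apply: (@mulIf _ (modulus z)); first by rewrite modulus_eq0.
by rewrite -modulusM mulVf // mulVf ?modulus1 // modulus_eq0.
Qed.

Lemma modulus_div z w : modulus (z / w) = modulus z / modulus w.
Proof. by rewrite modulusM modulusV. Qed.

Lemma modulusX z n : modulus (z ^+ n) = modulus z ^+ n.
Proof. by elim: n => [|n IH]; rewrite ?expr0 ?modulus1 // !exprS modulusM IH. Qed.

Lemma modulus_real (x : R) : modulus (x%:C%C : C) = `|x|.
Proof. by rewrite modulusE /= expr0n /= addr0 sqrtr_sqr. Qed.

Lemma modulus_sum (I : Type) (s : seq I) (F : I -> C) :
  modulus (\sum_(i <- s) F i) <= \sum_(i <- s) modulus (F i).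
Proof.
elim: s => [|i s IH]; first by rewrite !big_nil modulus0.
by rewrite !big_cons (le_trans (modulus_triangle _ _)) // lerD2l.
Qed.

Lemma Re_le_modulus z : `|complex.Re z| <= modulus z.
Proof.
by rewrite modulusE -(sqrtr_sqr (complex.Re z)) ler_wsqrtr // lerDl sqr_ge0.
Qed.

Lemma Im_le_modulus z : `|complex.Im z| <= modulus z.
Proof.
by rewrite modulusE -(sqrtr_sqr (complex.Im z)) ler_wsqrtr // lerDr sqr_ge0.
Qed.

Lemma modulus_le_ReIm z : modulus z <= `|complex.Re z| + `|complex.Im z|.
Proof.
case: z => a b /=.
have -> : (a +i* b)%C = (a%:C)%C + 'i%C * (b%:C)%C :> C.
  by rewrite {1}[(a +i* b)%C]complexE.
apply: (le_trans (modulus_triangle _ _)); rewrite modulusM !modulus_real.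
by rewrite modulusE /= expr0n expr1n add0r sqrtr1 mul1r.
Qed.

Lemma modulus_mul_close (M M' e : R) : 0 <= M -> 0 <= M' -> 0 < e ->
  exists2 d : R, 0 < d & forall x x' y y' : C, modulus x <= M -> modulus y <= M' ->
    modulus (x' - x) < d -> modulus (y' - y) < d -> modulus (x' * y' - x * y) < e.
Proof.
move=> M0 M0' e0; set K := 1 + M + M'; have K0 : 0 < K by rewrite /K; lra.
set d := Num.min 1 (e / 2 / K).
have d0 : 0 < d by rewrite lt_min ltr01 !divr_gt0.
have d1 : d <= 1 by rewrite ge_min lexx.
have dK : d * K <= e / 2 by rewrite -ler_pdivlMr // ge_min lexx orbT.
exists d => // x x' y y' xM yM h1 h2.
have -> : x' * y' - x * y = (x' - x) * y + x' * (y' - y) by ring.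
apply: (le_lt_trans (modulus_triangle _ _)); rewrite !modulusM.
have h3 : modulus x' <= 1 + M.
  by have := modulus_lower x' x; move: h1 d1 xM; lra.
have h4 : modulus (x' - x) * modulus y <= d * M' by rewrite ler_pM ?modulus_ge0 // ltW.
have h5 : modulus x' * modulus (y' - y) <= (1 + M) * d by rewrite ler_pM ?modulus_ge0 // ltW.
by move: h4 h5 dK e0; rewrite /K; lra.
Qed.

Lemma ReD z w : complex.Re (z + w) = complex.Re z + complex.Re w.
Proof. by case: z => a b; case: w. Qed.
Lemma ImD z w : complex.Im (z + w) = complex.Im z + complex.Im w.
Proof. by case: z => a b; case: w. Qed.
Lemma ReN z : complex.Re (- z) = - complex.Re z. Proof. by case: z. Qed.
Lemma ImN z : complex.Im (- z) = - complex.Im z. Proof. by case: z. Qed.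
Lemma ReB z w : complex.Re (z - w) = complex.Re z - complex.Re w.
Proof. by rewrite ReD ReN. Qed.
Lemma ImB z w : complex.Im (z - w) = complex.Im z - complex.Im w.
Proof. by rewrite ImD ImN. Qed.
Lemma ReM z w : complex.Re (z * w) =
  complex.Re z * complex.Re w - complex.Im z * complex.Im w.
Proof. by case: z => a b; case: w. Qed.
Lemma ImM z w : complex.Im (z * w) =
  complex.Re z * complex.Im w + complex.Im z * complex.Re w.
Proof. by case: z => a b; case: w => c d /=; rewrite addrC. Qed.
Lemma Re_realM (x : R) z : complex.Re ((x%:C)%C * z) = x * complex.Re z.
Proof. by case: z => a b /=; rewrite mul0r subr0. Qed.

Lemma Re_sum (I : Type) (s : seq I) (F : I -> C) :
  complex.Re (\sum_(i <- s) F i) = \sum_(i <- s) complex.Re (F i).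
Proof.
by elim: s => [|i s IH]; rewrite ?big_nil // !big_cons ReD IH.
Qed.

Lemma Re_inv z : complex.Re z^-1 = complex.Re z / modulus z ^+ 2.
Proof. by rewrite sqr_modulus; case: z. Qed.

Lemma mul_conjc z : z * (z^*)%C = ((modulus z ^+ 2)%:C)%C :> C.
Proof. by rewrite -sqr_normc normE rmorphXn. Qed.

End modulus.
#[global] Hint Extern 0 (is_true (_ <= modulus _)) => exact: modulus_ge0 : core.

(** * Counting zeros and poles in a disc *)

Section root_count.
Variable R : realType.
Local Notation C := (Cplx R).

(** Stands for: continuous on the closed unit disc and holomorphic inside. *)
Definition poly_approximable (g : C -> C) := forall e : R, 0 < e ->
  exists p : {poly C}, forall z, modulus z = 1 -> modulus (g z - p.[z]) <= e.

Lemma poly_approximable_poly (p : {poly C}) : poly_approximable (fun z => p.[z]).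
Proof. by move=> e e0; exists p => z _; rewrite subrr modulus0 ltW. Qed.

Lemma poly_bounded (p : {poly C}) :
  exists2 K : R, 0 < K & forall z, modulus z = 1 -> modulus p.[z] <= K.
Proof.
exists (1 + \sum_(i < size p) modulus p`_i).
  by rewrite ltr_pwDl //; apply: sumr_ge0 => i _; exact: modulus_ge0.
move=> z z1; rewrite horner_coef (le_trans (modulus_sum _ _)) //.
rewrite -[leLHS]add0r lerD // ler_sum // => i _.
by rewrite modulusM modulusX z1 expr1n mulr1.
Qed.

Lemma poly_approximable_bounded g : poly_approximable g ->
  exists2 K : R, 0 < K & forall z, modulus z = 1 -> modulus (g z) <= K.
Proof.
move=> /(_ 1 ltr01)[p hp]; have [K K0 hK] := poly_bounded p.
exists (1 + K); first by rewrite addr_gt0.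
move=> z z1; rewrite -(subrK p.[z] (g z)) (le_trans (modulus_triangle _ _)) //.
by rewrite lerD ?hp ?hK.
Qed.

Lemma poly_approximableM g h : poly_approximable g -> poly_approximable h ->
  poly_approximable (fun z => g z * h z).
Proof.
move=> gP hP e e0.
have [K K0 hK] := poly_approximable_bounded hP.
have [p hp] := gP (e / 2 / K) (divr_gt0 (divr_gt0 e0 (ltr0Sn _ 1)) K0).
have [L L0 hL] := poly_bounded p.
have [q hq] := hP (e / 2 / L) (divr_gt0 (divr_gt0 e0 (ltr0Sn _ 1)) L0).
exists (p * q) => z z1; rewrite hornerM.
have -> : g z * h z - p.[z] * q.[z] =
  (g z - p.[z]) * h z + p.[z] * (h z - q.[z]) by ring.
apply: (le_trans (modulus_triangle _ _)); rewrite !modulusM.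
rewrite [leRHS](splitr e) lerD //.
  have -> : e / 2 = e / 2 / K * K by rewrite mulfVK // gt_eqF.
  by rewrite ler_pM ?hp ?hK.
have -> : e / 2 = L * (e / 2 / L) by rewrite [RHS]mulrC mulfVK // gt_eqF.
by rewrite ler_pM ?hL ?hq.
Qed.

Lemma geometric_remainder (z : C) n : z != 1 ->
  (1 - z)^-1 - \sum_(i < n) z ^+ i = z ^+ n / (1 - z).
Proof.
move=> z1; have z1' : 1 - z != 0 by rewrite subr_eq0 eq_sym.
apply: (mulIf z1'); rewrite mulrBl mulVf // divfK //.
have := subrX1 z n => h.
have -> : (\sum_(i < n) z ^+ i) * (1 - z) = - (z ^+ n - 1) by rewrite h; ring.
ring.
Qed.

Lemma exp_small (q e : R) : 0 <= q < 1 -> 0 < e -> exists n, q ^+ n < e.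
Proof.
move=> /andP[q0 q1] e0.
have : (q ^+ n) @[n --> \oo] --> 0 by apply: cvg_expr; rewrite ger0_norm.
move=> /cvgrPdist_lt/(_ e e0)[n _ /(_ n (leqnn _)) /=].
by rewrite sub0r normrN ger0_norm ?exprn_ge0 // => ?; exists n.
Qed.

Lemma poly_approximable_geometric (c : C) : modulus c < 1 ->
  poly_approximable (fun z => (1 - c * z)^-1).
Proof.
move=> c1 e e0.
have d0 : 0 < 1 - modulus c by rewrite subr_gt0.
have [||n hn] := @exp_small (modulus c) (e * (1 - modulus c)).
- by rewrite modulus_ge0.
- by rewrite mulr_gt0.
exists (\poly_(i < n) c ^+ i) => z z1; rewrite horner_poly.
under eq_bigr do rewrite -exprMn.
have cz : modulus (c * z) = modulus c by rewrite modulusM z1 mulr1.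
rewrite geometric_remainder; last first.
  by apply: contraTneq c1 => h; rewrite -cz h modulus1 ltxx.
have h1 : 1 - modulus c <= modulus (1 - c * z).
  by have := modulus_lower 1 (c * z); rewrite modulus1 cz.
rewrite modulus_div modulusX cz ler_pdivrMr ?(lt_le_trans d0) //.
by apply: (le_trans (ltW hn)); rewrite ler_wpM2l // ltW.
Qed.

(** The mean of [z * g z] over the circle is its value 0 at the centre. The
    mean is taken over roots of unity, where it vanishes exactly for polynomials. *)
Lemma Re_not_bounded_below g (eta : R) : poly_approximable g -> 0 < eta ->
  ~ forall z : C, modulus z = 1 -> eta <= complex.Re (z * g z).
Proof.
move=> gP eta0 h.
have [p hp] := gP (eta / 2) (divr_gt0 eta0 (ltr0Sn _ 1)).
set M := (size p).+1.
have pP z : modulus z = 1 -> eta / 2 <= complex.Re (z * p.[z]).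
  move=> z1; have := h z z1; have -> : z * g z = z * p.[z] + z * (g z - p.[z]) by ring.
  rewrite ReD => h1; have := Re_le_modulus (z * (g z - p.[z])).
  have := hp z z1; rewrite modulusM z1 mul1r => h2 h3.
  move: (le_trans h3 h2); rewrite ler_norml => /andP[_]; lra.
have [w wP] : exists w : C, M.-primitive_root w.
  have [rs hrs] := closed_field_poly_normal ('X^M - 1 : {poly C}).
  have M0 : (0 < M)%N by [].
  rewrite (monicP (monic_Xn_sub_1 _ M0)) scale1r in hrs.
  have rn1 : all M.-unity_root rs by apply/allP => z; rewrite -root_prod_XsubC -hrs.
  have sz_rs : (M <= size rs)%N.
    by rewrite -ltnS -(size_prod_XsubC rs id) -hrs size_Xn_sub_1.
  have [|w _ wP] := hasP (has_prim_root M0 rn1 _ sz_rs); last by exists w.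
  rewrite -separable_prod_XsubC -hrs separable_Xn_sub_1 //.
  by rewrite pnatr_eq0.
have w1 j : modulus (w ^+ j) = 1.
  have : modulus w ^+ M = 1 by rewrite -modulusX (prim_expr_order wP) modulus1.
  move=> /eqP; rewrite pexpr_eq1 // => /eqP wm.
  by rewrite modulusX wm expr1n.
have sum0 k : (0 < k < M)%N -> \sum_(j < M) (w ^+ j) ^+ k = 0.
  move=> /andP[k0 kM].
  have wk : w ^+ k != 1.
    by rewrite -(prim_order_dvd wP) gtnNdvd.
  have := subrX1 (w ^+ k) M; rewrite -exprM mulnC exprM (prim_expr_order wP) expr1n subrr.
  move/esym/eqP; rewrite mulf_eq0 subr_eq0 (negbTE wk) /= => /eqP h0; rewrite -[RHS]h0.
  by apply: eq_bigr => i _; rewrite -!exprM mulnC.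
have : \sum_(j < M) (w ^+ j * p.[w ^+ j]) = 0.
  under eq_bigr => j _ do rewrite horner_coef mulr_sumr.
  rewrite exchange_big /= big1 // => i _.
  under eq_bigr => j _ do rewrite mulrCA -exprS.
  by rewrite -mulr_sumr sum0 ?mulr0 //= ltnS.
move=> /(congr1 (@complex.Re R)); rewrite Re_sum /=.
have hM : \sum_(j < M) (eta / 2) <= \sum_(j < M) complex.Re (w ^+ j * p.[w ^+ j]).
  by apply: ler_sum => j _; exact: pP.
move=> h0; move: hM; rewrite h0 sumr_const card_ord.
apply/negP; rewrite -ltNge pmulrn_lgt0 // divr_gt0 //.
Qed.

(** Shape of a finite product of factors [z - a] and [1 / (z - b)] on the unit
    circle: up to a positive function, [z ^ m] times a holomorphic one. *)
Definition winding_form (m : nat) (F : C -> C) := exists g (t : C -> R) (K : R),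
  [/\ poly_approximable g, forall z, modulus z = 1 -> 0 < t z <= K &
      forall z, modulus z = 1 -> F z = z ^+ m * ((t z)%:C)%C * g z].

Lemma winding_form_ext m F G : (forall z, modulus z = 1 -> F z = G z) ->
  winding_form m F -> winding_form m G.
Proof.
move=> FG [g [t [K [gP tP eP]]]]; exists g, t, K; split=> // z z1.
by rewrite -FG // eP.
Qed.

Lemma winding_formM m n F G : winding_form m F -> winding_form n G ->
  winding_form (m + n) (fun z => F z * G z).
Proof.
move=> [g [t [K [gP tP eP]]]] [g' [t' [K' [gP' tP' eP']]]].
exists (fun z => g z * g' z), (fun z => t z * t' z), (K * K'); split.
- exact: poly_approximableM.
- move=> z z1; have /andP[a b] := tP z z1; have /andP[a' b'] := tP' z z1.
  by rewrite mulr_gt0 //= ler_pM // ltW.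
- by move=> z z1; rewrite eP // eP' // exprD rmorphM /=; ring.
Qed.

Lemma winding_form_holo g : poly_approximable g -> winding_form 0 g.
Proof.
move=> gP; exists g, (fun=> 1), 1; split=> // z _; first by rewrite ltr01 lexx.
by rewrite expr0 rmorph1 !mul1r.
Qed.

Lemma circle_conj (a z : C) : modulus z = 1 ->
  z - a = z * (1 - (a^*)%C * z)^*%C.
Proof.
move=> z1; rewrite rmorphB rmorph1 rmorphM /= conjcK mulrBr mulr1.
by rewrite mulrCA mul_conjc z1 expr1n mulr1.
Qed.

Lemma modulus_conj (z : C) : modulus (z^*)%C = modulus z.
Proof. by rewrite /modulus normcJ. Qed.

Lemma inside_factor_neq0 (a z : C) : modulus a < 1 -> modulus z = 1 ->
  0 < 1 - modulus a <= modulus (1 - (a^*)%C * z).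
Proof.
move=> a1 z1; rewrite subr_gt0 a1 /=.
by have := modulus_lower 1 ((a^*)%C * z);
  rewrite modulus1 modulusM z1 mulr1 modulus_conj.
Qed.

Lemma winding_form_zero_inside (a : C) : modulus a < 1 ->
  winding_form 1 (fun z => z - a).
Proof.
move=> a1; exists (fun z => (1 - (a^*)%C * z)^-1),
  (fun z => modulus (1 - (a^*)%C * z) ^+ 2), (2 ^+ 2); split.
- by apply: poly_approximable_geometric; rewrite modulus_conj.
- move=> z z1; have /andP[d0 d] := inside_factor_neq0 a1 z1.
  rewrite exprn_gt0 ?(lt_le_trans d0) //= lerXn2r ?nnegrE //.
  apply: (le_trans (modulus_triangleB _ _)).
  by rewrite modulus1 modulusM z1 mulr1 modulus_conj; move: a1; lra.
- move=> z z1; have /andP[d0 d] := inside_factor_neq0 a1 z1.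
  have nz : 1 - (a^*)%C * z != 0 by rewrite -modulus_gt0 (lt_le_trans d0).
  rewrite expr1 circle_conj // -mul_conjc; rewrite -!mulrA; congr (_ * _).
  by rewrite mulrCA mulfV // mulr1.
Qed.

Lemma winding_form_zero_outside (a : C) : winding_form 0 (fun z => z - a).
Proof.
apply: winding_form_holo.
have := poly_approximable_poly ('X - a%:P); congr poly_approximable.
by apply/funext => z; rewrite hornerXsubC.
Qed.

(** Only [z / (z - b)] is used, so that exponents stay natural numbers. *)
Lemma winding_form_pole_inside (b : C) : modulus b < 1 ->
  winding_form 0 (fun z => z / (z - b)).
Proof.
move=> b1; exists (fun z => 1 - (b^*)%C * z),
  (fun z => (modulus (1 - (b^*)%C * z) ^+ 2)^-1), ((1 - modulus b) ^- 2); split.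
- have := poly_approximable_poly (1 - (b^*)%C *: 'X); congr poly_approximable.
  by apply/funext => z; rewrite !hornerE.
- move=> z z1; have /andP[d0 d] := inside_factor_neq0 b1 z1.
  rewrite invr_gt0 exprn_gt0 ?(lt_le_trans d0) //=.
  by rewrite lef_pV2 ?posrE ?exprn_gt0 ?(lt_le_trans d0) // lerXn2r ?nnegrE // ltW.
- move=> z z1; have /andP[d0 d] := inside_factor_neq0 b1 z1.
  have nz : 1 - (b^*)%C * z != 0 by rewrite -modulus_gt0 (lt_le_trans d0).
  have z0 : z != 0 by rewrite -modulus_gt0 z1.
  have nz' : ((1 - (b^*)%C * z)^*)%C != 0 by rewrite conjc_eq0.
  rewrite expr0 mul1r circle_conj // fmorphV /= -mul_conjc.
  move: nz nz'; move: (1 - _) => u; move: (u^*)%C => v u0 v0.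
  by field; rewrite u0 v0 z0.
Qed.

Lemma winding_form_pole_outside (b : C) : 1 < modulus b ->
  winding_form 0 (fun z => (z - b)^-1).
Proof.
move=> b1; have b0 : b != 0 by rewrite -modulus_gt0 (lt_trans ltr01).
apply: winding_form_holo.
have -> : (fun z => (z - b)^-1) = (fun z => (- b^-1) * (1 - b^-1 * z)^-1).
  apply/funext => z; rewrite -invrN -invfM; congr (_^-1).
  by rewrite mulrBr mulr1 !mulNr opprK mulrA mulfV // mul1r addrC.
apply: poly_approximableM.
  have := poly_approximable_poly (- b^-1)%:P; congr poly_approximable.
  by apply/funext => z; rewrite hornerC.
by apply: poly_approximable_geometric; rewrite modulusV invf_lt1 // (lt_trans ltr01).
Qed.

Lemma winding_form_zeros (s : seq C) :
  winding_form (count (fun a => modulus a < 1) s) (fun z => \prod_(a <- s) (z - a)).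
Proof.
elim: s => [|a s IH] /=.
  apply: (@winding_form_ext _ (fun=> 1)); first by move=> z _; rewrite big_nil.
  apply: winding_form_holo.
  have := poly_approximable_poly 1; congr poly_approximable.
  by apply/funext => z; rewrite hornerC.
apply: (winding_form_ext (F := fun z => (z - a) * \prod_(a <- s) (z - a))).
  by move=> z _; rewrite big_cons.
case: (boolP (modulus a < 1)) => [a1|_]; first exact/winding_formM/IH/winding_form_zero_inside.
exact/winding_formM/IH/winding_form_zero_outside.
Qed.

Lemma winding_form_poles (s : seq C) : all (fun b => modulus b != 1) s ->
  winding_form 0 (fun z => z ^+ count (fun b => modulus b < 1) s /
                           \prod_(b <- s) (z - b)).
Proof.
elim: s => [_|b s IH] /=.
  apply: (@winding_form_ext _ (fun=> 1)).
    by move=> z _; rewrite big_nil expr0 mul1r invr1.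
  apply: winding_form_holo.
  have := poly_approximable_poly 1; congr poly_approximable.
  by apply/funext => z; rewrite hornerC.
move=> /andP[b1 /IH{}IH].
case: ltP => b1'.
  apply: winding_form_ext (winding_formM (winding_form_pole_inside b1') IH).
  by move=> z _; rewrite big_cons addSn exprS invfM; ring.
have {b1'} b1' : 1 < modulus b by rewrite lt_def b1.
apply: winding_form_ext (winding_formM (winding_form_pole_outside b1') IH).
by move=> z _; rewrite big_cons add0n invfM; ring.
Qed.

Lemma Re_div_lower (k w : C) : k != 0 -> modulus (w - k) <= modulus k / 2 ->
  w != 0 /\ 1 / 8 <= complex.Re (k / w).
Proof.
move=> k0 h; have kp : 0 < modulus k by rewrite modulus_gt0.
have w0 : w != 0.
  by apply: contraTneq h => ->; rewrite sub0r modulusN -ltNge; move: kp; lra.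
split=> //; set u := w / k.
have u1 : modulus (u - 1) <= 1 / 2.
  have -> : u - 1 = (w - k) / k by rewrite mulrBl divff.
  by rewrite modulus_div ler_pdivrMr // mulrC mulrA mulr1.
have -> : k / w = u^-1 by rewrite invf_div.
have u0 : u != 0 by rewrite mulf_neq0 // invr_eq0.
have up : 0 < modulus u by rewrite modulus_gt0.
rewrite Re_inv ler_pdivlMr ?exprn_gt0 //.
have := Re_le_modulus (u - 1); rewrite ReB /= ler_norml => /andP[h1 _].
have h2 : modulus u <= 2.
  have := modulus_triangle (u - 1) 1; rewrite subrK modulus1; lra.
have h3 : modulus u ^+ 2 <= 2 ^+ 2 by rewrite lerXn2r ?nnegrE.
move: h1 u1 h3; rewrite expr2; lra.
Qed.

(** Rouche's argument: were there more poles than zeros in the disc, the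
    reciprocal, of positive real part on the circle, would have the winding form
    of a holomorphic function vanishing at the centre. *)
Lemma count_poles_le_zeros (l k : C) (zs ps : seq C) : k != 0 ->
  (forall z, modulus z = 1 ->
    modulus (l * \prod_(b <- zs) (z - b) / \prod_(a <- ps) (z - a) - k)
      <= modulus k / 2) ->
  (count (fun a => (modulus a < 1)%R) ps <= count (fun b => (modulus b < 1)%R) zs)%N.
Proof.
move=> k0 h; rewrite leqNgt; apply/negP => lt_zs_ps.
set a := count _ zs in lt_zs_ps; set b := count _ ps in lt_zs_ps.
have l0 : l != 0.
  have [] := Re_div_lower k0 (h 1 (modulus1 R)).
  by rewrite !mulf_eq0 !negb_or => /andP[/andP[]].
have zs1 : all (fun b => modulus b != 1) zs.
  apply/allP => c cz; apply/negP => /eqP c1.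
  have [+ _] := Re_div_lower k0 (h c c1); apply/negP; rewrite negbK.
  rewrite mulf_eq0 mulf_eq0; apply/orP; left; apply/orP; right.
  by rewrite prodf_seq_eq0; apply/hasP; exists c => //=; rewrite subrr.
have [g [t [K [gP tP eP]]]] :=
  winding_formM (winding_form_zeros ps) (winding_form_poles zs1).
rewrite addn0 -/b in eP.
have K0 : 0 < K by have /andP[] := tP 1 (modulus1 R); exact: lt_le_trans.
have [n bE] : exists n, b = (a + n.+1)%N.
  by exists (b - a.+1)%N; rewrite addnS -addSn subnKC.
have cP : poly_approximable (fun z => (k / l * z ^+ n) * g z).
  apply: poly_approximableM gP.
  have := poly_approximable_poly (k / l *: 'X^n); congr poly_approximable.
  by apply/funext => z; rewrite hornerZ hornerXn.
apply: (Re_not_bounded_below (eta := 1 / 8 / K) cP); first by rewrite !divr_gt0.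
move=> z z1; have [_] := Re_div_lower k0 (h z z1).
have z0 : z != 0 by rewrite -modulus_gt0 z1.
have zn0 m : z ^+ m != 0 by rewrite expf_neq0.
have {}eP := eP z z1; have /andP[t0 tK] := tP z z1.
have -> : k / (l * \prod_(b0 <- zs) (z - b0) / \prod_(a0 <- ps) (z - a0)) =
    ((t z)%:C)%C * (z * (k / l * z ^+ n * g z)).
  apply: (mulIf (zn0 a)).
  have -> : k / (l * \prod_(b0 <- zs) (z - b0) / \prod_(a0 <- ps) (z - a0)) * z ^+ a =
    k / l * (\prod_(a <- ps) (z - a) *
     (z ^+ a / \prod_(b <- zs) (z - b))).
    by rewrite invf_div invfM; ring.
  by rewrite eP bE exprD exprS; ring.
rewrite Re_realM => hh.
have : 1 / 8 <= K * complex.Re (z * (k / l * z ^+ n * g z)).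
  apply: (le_trans hh); rewrite ler_wpM2r //.
  have : 0 < t z * complex.Re (z * (k / l * z ^+ n * g z)).
    by apply: lt_le_trans hh; rewrite divr_gt0.
  by rewrite pmulr_rgt0 // => /ltW.
by move=> hK; rewrite ler_pdivrMr // [leRHS]mulrC.
Qed.

End root_count.

(** * A planar Cantor set coded by binary words *)

Section words.
Variable R : realType.
Local Notation C := (Cplx R).
Implicit Types v w p : seq bool.

(** Two maps [z -> beta * z] and [z -> 1 + beta * z]. The ratio [3 / 5] exceeds
    [1 / 2], so that Cauchy transforms of the Bernoulli measure are continuous, and
    its square is below [1 / 2], so that the attractor, a product of two linear Cantor
    sets because [beta] is imaginary, is totally disconnected. *)
Definition ratio : R := 3 / 5.
Definition beta : C := Complex 0 ratio.

Fixpoint center w : C := if w is a :: w' then a%:R + beta * center w' else 0.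

Definition radius n : R := ratio ^+ n / 4.

(** Here [e] ranges over the unit circle. The disc need not contain the part of the Cantor
    set coded by [v]: what counts is that the discs of one level are disjoint and that
    their diameters tend to 0. *)
Definition circle_point v (e : C) : C := center v + ((radius (size v))%:C)%C * e.

Fixpoint agreement v w : nat := match v, w with
  | a :: v', c :: w' => if a == c then (agreement v' w').+1 else 0
  | _, _ => 0 end.

Lemma ratio_gt0 : 0 < ratio. Proof. by rewrite /ratio; lra. Qed.
Lemma ratio_lt1 : ratio < 1. Proof. by rewrite /ratio; lra. Qed.
Lemma ratioX_gt0 n : 0 < ratio ^+ n. Proof. by rewrite exprn_gt0 // ratio_gt0. Qed.
Lemma radius_gt0 n : 0 < radius n.
Proof. by rewrite divr_gt0 ?ratioX_gt0. Qed.

Lemma ratioX_le m n : (m <= n)%N -> ratio ^+ n <= ratio ^+ m.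
Proof. by move=> mn; rewrite ler_wiXn2l ?ltW ?ratio_gt0 ?ratio_lt1. Qed.

Lemma modulus_beta : modulus beta = ratio.
Proof. by rewrite modulusE /= expr0n add0r sqrtr_sqr ger0_norm // ltW // ratio_gt0. Qed.

Lemma Re_beta z : complex.Re (beta * z) = - (ratio * complex.Im z).
Proof. by rewrite ReM /= mul0r add0r. Qed.

Lemma Im_beta z : complex.Im (beta * z) = ratio * complex.Re z.
Proof. by rewrite ImM /= mul0r add0r. Qed.

Lemma Re_bool (a : bool) : complex.Re (a%:R : C) = a%:R.
Proof. by case: a. Qed.
Lemma Im_bool (a : bool) : complex.Im (a%:R : C) = 0.
Proof. by case: a. Qed.

(** The bounds [y = 625 / 544] and [x = - 225 / 544] for the real part solve
    [y = 1 - ratio ^ 2 * x] and [x = - ratio ^ 2 * y]; those for the imaginary part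
    are [ratio] times as large. *)
Lemma center_bounds w :
  [/\ - (225 / 544) <= complex.Re (center w), complex.Re (center w) <= 625 / 544,
      - (135 / 544) <= complex.Im (center w) & complex.Im (center w) <= 375 / 544].
Proof.
elim: w => [|a w [h1 h2 h3 h4]] /=; first by split; lra.
rewrite ReD ImD Re_beta Im_beta Re_bool Im_bool /ratio.
by case: a; rewrite ?mulr1n ?mulr0n; split; lra.
Qed.

Lemma modulus_center w : modulus (center w) <= 2.
Proof.
have [h1 h2 h3 h4] := center_bounds w.
apply: (le_trans (modulus_le_ReIm _)).
have : `|complex.Re (center w)| <= 625 / 544 by rewrite ler_norml; apply/andP; split; lra.
have : `|complex.Im (center w)| <= 375 / 544 by rewrite ler_norml; apply/andP; split; lra.
lra.
Qed.

Lemma Re_center_cons a w :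
  if a then 319 / 544 <= complex.Re (center (a :: w))
  else complex.Re (center (a :: w)) <= 81 / 544.
Proof.
have [_ _ h3 h4] := center_bounds w.
by case: a => /=; rewrite ReD Re_beta /ratio /=; lra.
Qed.

Lemma center_cat p w : center (p ++ w) = center p + beta ^+ size p * center w.
Proof.
elim: p => [|a p IH] /=; first by rewrite add0r expr0 mul1r.
by rewrite IH exprS mulrDr mulrA addrA.
Qed.

Lemma center_rcons w a : center (rcons w a) = center w + beta ^+ size w * a%:R.
Proof. by rewrite -cats1 center_cat /= mulr0 addr0. Qed.

Lemma agreement_refl w : agreement w w = size w.
Proof. by elim: w => //= a w ->; rewrite eqxx. Qed.

Lemma agreement_lt v w : size v = size w -> v != w -> (agreement v w < size w)%N.
Proof.
elim: v w => [|a v IH] [|c w] //= [] svw; rewrite eqseq_cons.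
by case: eqVneq => //= _ /(IH _ svw).
Qed.

Lemma agreement_rcons v w a c : size v = size w ->
  (agreement (rcons v a) (rcons w c) <= (agreement v w).+1)%N.
Proof.
elim: v w => [|b v IH] [|d w] //= => [_|[] /IH]; first by case: ifP.
by case: ifP.
Qed.

Lemma agreement_nth v w k : (k < size v)%N -> (k < size w)%N ->
  nth false v k != nth false w k -> (agreement v w <= k)%N.
Proof.
elim: v w k => [|a v IH] [|c w] [|k] //= => [_ _ /negbTE ->//|kv kw vw].
by case: ifP => // _; exact: IH.
Qed.

Lemma agreement_cat p w v :
  (agreement (p ++ w) v <= size p + agreement w (drop (size p) v))%N.
Proof.
elim: p v => [|a p IH] [|c v] //=; rewrite ?drop0 //.
by case: ifP => // _; rewrite addSn ltnS.
Qed.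

(** At the first differing digit, the real parts are 7 / 16 apart by [center_bounds]. *)
Lemma center_gap v w : size v = size w -> v != w ->
  7 / 16 * ratio ^+ agreement v w <= modulus (center v - center w).
Proof.
elim: v w => [|a v IH] [|c w] //= [] svw; rewrite eqseq_cons.
have [<- /= vw|ac _] := eqVneq a c.
  have := IH _ svw vw.
  have -> : a%:R + beta * center v - (a%:R + beta * center w) =
    beta * (center v - center w) by ring.
  rewrite modulusM modulus_beta exprS => h.
  by rewrite mulrCA ler_wpM2l // ltW // ratio_gt0.
rewrite expr0 mulr1; apply: (le_trans _ (Re_le_modulus _)).
have hv := Re_center_cons a v; have hw := Re_center_cons c w.
rewrite ReB -/(center (a :: v)) -/(center (c :: w)) ler_normr.
by case: a c ac hv hw => [] [] // _ hv hw; apply/orP; [left|right]; move: hv hw => /=; lra.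
Qed.

Lemma modulus_radiusM n e : modulus e = 1 ->
  modulus (((radius n)%:C)%C * e : C) = radius n.
Proof. by move=> e1; rewrite modulusM e1 mulr1 modulus_real gtr0_norm // radius_gt0. Qed.

Lemma circle_point_gap v w e : size w = size v -> modulus e = 1 ->
  ratio ^+ agreement w v / 4 <= modulus (center w - circle_point v e).
Proof.
move=> swv e1; rewrite /circle_point opprD addrA.
have [->|wv] := eqVneq w v.
  by rewrite subrr sub0r modulusN modulus_radiusM // agreement_refl.
apply: (le_trans _ (modulus_lower _ _)); rewrite modulus_radiusM //.
have h1 := center_gap swv wv; have h2 := ratioX_le (agreement_lt swv wv).
have := ratioX_gt0 (agreement w v); move: h1 h2.
rewrite /radius exprS; set x := ratio ^+ _; set y := ratio ^+ size v; set m := modulus _.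
by rewrite /ratio => *; lra.
Qed.

Lemma modulus_bool (a : bool) : modulus (a%:R : C) <= 1.
Proof. by case: a; rewrite ?modulus1 ?modulus0. Qed.

Lemma center_rcons_dist v a : modulus (center (rcons v a) - center v) <= ratio ^+ size v.
Proof.
rewrite center_rcons addrC addKr modulusM modulusX modulus_beta.
by rewrite ler_piMr ?modulus_bool // ltW // ratioX_gt0.
Qed.

Lemma circle_point_dist v e : modulus e = 1 ->
  modulus (circle_point v e - center v) = radius (size v).
Proof. by move=> e1; rewrite /circle_point addrC addKr modulus_radiusM. Qed.

Lemma cells_disjoint v w z : size v = size w ->
  modulus (z - center v) < radius (size v) ->
  modulus (z - center w) < radius (size w) -> v = w.
Proof.
move=> svw hv hw; apply/eqP; apply: contraT => vw.
have h1 := center_gap svw vw; have h2 := ratioX_le (agreement_lt svw vw).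
have h3 := modulus_dist (center v) z (center w).
have := ratioX_gt0 (agreement v w); move: h1 h2 h3 hv hw.
rewrite svw (modulusB _ z) /radius exprS.
set x := ratio ^+ _; set y := ratio ^+ size w.
rewrite /ratio => *; suff : (0 : R) < 0 by rewrite ltxx.
by lra.
Qed.

End words.

(** * Averages over words *)

Section averages.

Fixpoint average (K : fieldType) n (F : seq bool -> K) : K :=
  if n is n'.+1 then (average n' (fun w => F (false :: w)) +
                      average n' (fun w => F (true :: w))) / 2
  else F [::].

Lemma eq_average (K : fieldType) n (F G : seq bool -> K) :
  (forall w, size w = n -> F w = G w) -> average n F = average n G.
Proof.
elim: n F G => [|n IH] F G FG /=; first exact: FG.
by congr ((_ + _) / 2); apply: IH => w sw; apply: FG; rewrite /= sw.
Qed.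

Lemma average_rcons (K : fieldType) n (F : seq bool -> K) :
  average n.+1 F = average n (fun w => (F (rcons w false) + F (rcons w true)) / 2).
Proof.
elim: n F => [|n IH] F //.
by rewrite [RHS]/= -(IH (fun w => F (false :: w))) -(IH (fun w => F (true :: w))).
Qed.

Lemma averageB (K : fieldType) n (F G : seq bool -> K) :
  average n F - average n G = average n (fun w => F w - G w).
Proof. by elim: n F G => [|n IH] F G //=; rewrite -!IH; ring. Qed.

Lemma averageZ (K : fieldType) n c (F : seq bool -> K) :
  average n (fun w => c * F w) = c * average n F.
Proof. by elim: n F => [|n IH] F //=; rewrite !IH; ring. Qed.

Lemma average_cst (K : numFieldType) n (c : K) : average n (fun=> c) = c.
Proof. by elim: n => [|n IH] //=; rewrite IH; field. Qed.

Lemma ler_average (K : numFieldType) n (F G : seq bool -> K) :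
  (forall w, size w = n -> F w <= G w) -> average n F <= average n G.
Proof.
elim: n F G => [|n IH] F G FG /=; first exact: FG.
by rewrite ler_pM2r ?invr_gt0 // lerD //; apply: IH => w sw; apply: FG; rewrite /= sw.
Qed.

Lemma modulus_average (R : realType) n (F : seq bool -> Cplx R) :
  modulus (average n F) <= average n (fun w => modulus (F w)).
Proof.
elim: n F => [|n IH] F //=.
have -> : (2 : Cplx R) = ((2%:R : R)%:C)%C by rewrite rmorph_nat.
rewrite modulus_div modulus_real normr_nat ler_pM2r ?invr_gt0 //.
by apply: (le_trans (modulus_triangle _ _)); rewrite lerD.
Qed.

End averages.

Section energy.
Variable R : realType.
Local Notation C := (Cplx R).
Local Notation ratio := (ratio R).
Implicit Types v w p : seq bool.

(** Discrete energy of the Bernoulli measure: [agreement w v = k] has probability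
    of order [2 ^ -k], so this grows like the powers of [1 / (2 * ratio ^ 2)]. *)
Lemma average_agreement m v : size v = m ->
  average m (fun w => ratio ^- (2 * agreement w v)) <= 3 * (25 / 18) ^+ m.
Proof.
move=> sv; suff : average m (fun w => ratio ^- (2 * agreement w v)) + 9 / 7 <=
    16 / 7 * (25 / 18) ^+ m.
  have : 0 <= (25 / 18 : R) ^+ m by rewrite exprn_ge0.
  by set x := _ ^+ m; set y := average _ _; lra.
elim: m v sv => [[]//= _|m IH [|a v]//= [] sv].
  by rewrite expr0 invr1; lra.
have {IH} := IH v sv; set x := average m _; set y := _ ^+ m => h.
have half c : c != a ->
    average m (fun w => ratio ^- (2 * (if c == a then (agreement w v).+1 else 0))) = 1.
  by move=> /negbTE ->; rewrite muln0 invr1 average_cst.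
have same : average m (fun w => ratio ^- (2 * (if a == a then (agreement w v).+1 else 0)))
    = 25 / 9 * x.
  rewrite /x -averageZ; apply: eq_average => w _; rewrite eqxx mulnS exprD invfM.
  by congr (_ * _); rewrite /ratio; lra.
have -> : average m (fun w => ratio ^- (2 * (if false == a then (agreement w v).+1 else 0))) +
  average m (fun w => ratio ^- (2 * (if true == a then (agreement w v).+1 else 0))) =
  1 + 25 / 9 * x.
  case: a same half => same half; first by rewrite (half false isT) same.
  by rewrite same (half true isT) addrC.
by rewrite exprS -/y; lra.
Qed.

(** Cauchy transform of the normalised Bernoulli measure on the cell [p],
    discretised by the words of length [size p + m]. *)
Definition cauchy_sum p m (z : C) : C := average m (fun w => (center R (p ++ w) - z)^-1).

Lemma inv_dist (x y : C) (d1 d2 : R) : 0 < d1 -> 0 < d2 ->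
  d1 <= modulus x -> d2 <= modulus y ->
  modulus (x^-1 - y^-1) <= modulus (y - x) / (d1 * d2).
Proof.
move=> d10 d20 h1 h2.
have x0 : x != 0 by rewrite -modulus_gt0 (lt_le_trans d10).
have y0 : y != 0 by rewrite -modulus_gt0 (lt_le_trans d20).
have -> : x^-1 - y^-1 = (y - x) / (x * y) by field; rewrite x0 y0.
rewrite modulus_div modulusM ler_wpM2l // lef_pV2 ?posrE ?mulr_gt0 ?modulus_gt0 //.
by rewrite ler_pM // ltW.
Qed.

Lemma kernel_step w v a c e e' : size w = size v -> modulus e = 1 -> modulus e' = 1 ->
  modulus ((center R w - circle_point v e)^-1 -
           (center R (rcons w c) - circle_point (rcons v a) e')^-1)
  <= 64 * ratio ^+ size v * ratio ^- (2 * agreement w v).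
Proof.
move=> swv e1 e1'.
set d := agreement w v; have dp := ratioX_gt0 R d.
have h1 := circle_point_gap swv e1.
have h2 : ratio ^+ d * (3 / 20) <= modulus (center R (rcons w c) - circle_point (rcons v a) e').
  apply: (le_trans _ (circle_point_gap _ e1')); last by rewrite !size_rcons swv.
  have := ratioX_le R (agreement_rcons c a swv); rewrite exprS -/d.
  by set x := ratio ^+ d; set y := ratio ^+ _; rewrite /ratio; lra.
apply: (le_trans (inv_dist _ _ h1 h2)); [by rewrite divr_gt0|by rewrite mulr_gt0|].
have -> : ratio ^- (2 * d) = (ratio ^+ d)^-1 * (ratio ^+ d)^-1.
  by rewrite mul2n -addnn exprD invfM.
rewrite -/d; set x := ratio ^+ d in dp *.
have num : modulus (center R (rcons w c) - circle_point (rcons v a) e' -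
    (center R w - circle_point v e)) <= 12 / 5 * ratio ^+ size v.
  have -> : center R (rcons w c) - circle_point (rcons v a) e' - (center R w - circle_point v e) =
     (center R (rcons w c) - center R w) + (- (circle_point (rcons v a) e' - center R (rcons v a)) +
     (- (center R (rcons v a) - center R v) + (circle_point v e - center R v))).
    ring.
  apply: (le_trans (modulus_triangle4 _ _ _ _)).
  rewrite !modulusN (circle_point_dist v e1) (circle_point_dist (rcons v a) e1').
  have := center_rcons_dist R w c; have := center_rcons_dist R v a.
  rewrite swv size_rcons /radius exprS; set y := ratio ^+ size v.
  by rewrite /ratio; lra.
rewrite ler_pdivrMr ?mulr_gt0 ?divr_gt0 //.
apply: (le_trans num); rewrite le_eqVlt; apply/orP; left; apply/eqP.
by field; rewrite gt_eqF.
Qed.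

(** Consecutive discretisations agree up to a geometric error on the circles;
    letting both boundary points vary also shows that each is nearly constant there. *)
Lemma cauchy_sum_step p m v a e e' : size v = (size p + m)%N ->
  modulus e = 1 -> modulus e' = 1 ->
  modulus (cauchy_sum p m (circle_point v e) -
           cauchy_sum p m.+1 (circle_point (rcons v a) e'))
  <= 192 * (5 / 3) ^+ size p * (5 / 6) ^+ m.
Proof.
move=> sv e1 e1'; rewrite /cauchy_sum average_rcons averageB.
apply: (le_trans (modulus_average _ _)).
set k := size p.
have key w : size w = m ->
    modulus ((center R (p ++ w) - circle_point v e)^-1 -
      ((center R (p ++ rcons w false) - circle_point (rcons v a) e')^-1 +
       (center R (p ++ rcons w true) - circle_point (rcons v a) e')^-1) / 2)
    <= 64 * ratio ^+ size v * ratio ^- (2 * k) * ratio ^- (2 * agreement w (drop k v)).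
  move=> sw; have spw : size (p ++ w) = size v by rewrite size_cat sw sv.
  have h0 := kernel_step a false spw e1 e1'.
  have h1 := kernel_step a true spw e1 e1'.
  rewrite !rcons_cat in h0 h1.
  set x := (center R (p ++ w) - _)^-1 in h0 h1 *.
  set y := (center R (p ++ rcons w false) - _)^-1 in h0 *.
  set u := (center R (p ++ rcons w true) - _)^-1 in h1 *.
  have -> : x - (y + u) / 2 = ((x - y) + (x - u)) / 2 by field.
  have -> : (2 : C) = ((2%:R : R)%:C)%C by rewrite rmorph_nat.
  rewrite modulus_div modulus_real normr_nat.
  have := modulus_triangle (x - y) (x - u) => h2.
  have : 64 * ratio ^+ size v * ratio ^- (2 * agreement (p ++ w) v) <=
    64 * ratio ^+ size v * ratio ^- (2 * k) * ratio ^- (2 * agreement w (drop k v)).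
    rewrite -[leRHS]mulrA; apply: ler_wpM2l.
      by rewrite mulr_ge0 // ltW // ratioX_gt0.
    rewrite -invfM -exprD lef_pV2 ?posrE ?ratioX_gt0 // ratioX_le // -mulnDr.
    by rewrite leq_mul2l agreement_cat.
  by move: h0 h1 h2; lra.
apply: (le_trans (ler_average key)); rewrite averageZ.
apply: (le_trans (y := 64 * ratio ^+ size v * ratio ^- (2 * k) * (3 * (25 / 18) ^+ m))).
  apply: ler_wpM2l.
    by rewrite !mulr_ge0 ?invr_ge0 // ltW // ratioX_gt0.
  by apply: average_agreement; rewrite size_drop sv addKn.
rewrite sv exprD -/k le_eqVlt; apply/orP; left; apply/eqP.
have -> : ratio ^- (2 * k) = (ratio ^+ k)^-1 * (ratio ^+ k)^-1.
  by rewrite mul2n -addnn exprD invfM.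
have -> : (5 / 3 : R) ^+ k = (ratio ^+ k)^-1.
  by rewrite -exprVn; congr (_ ^+ _); rewrite /ratio; lra.
have -> : (5 / 6 : R) ^+ m = ratio ^+ m * (25 / 18) ^+ m.
  by rewrite -exprMn; congr (_ ^+ _); rewrite /ratio; lra.
by field; rewrite gt_eqF // ratioX_gt0.
Qed.

(** The mass of a small cell at the point [a] acts on the other half of the
    Cantor set like the mass of that point. *)
Lemma cauchy_sum_far (a : bool) k m v e (y : C) :
  size v = (k.+1 + m)%N -> agreement (a :: nseq k false) v = 0%N -> modulus e = 1 ->
  modulus (y - center R v) <= 5 * ratio ^+ size v -> 7 / 16 <= modulus (a%:R - y) ->
  modulus (cauchy_sum (a :: nseq k false) m (circle_point v e) - (a%:R - y)^-1)
  <= 80 * ratio ^+ k.+1.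
Proof.
move=> sv av e1 yv ay; set p := a :: nseq k false.
have sp : size p = k.+1 by rewrite /= size_nseq.
have cp : center R p = a%:R.
  rewrite /=; have -> : center R (nseq k false) = 0.
    by elim: k {sv av p sp} => //= k ->; rewrite mulr0 addr0.
  by rewrite mulr0 addr0.
rewrite /cauchy_sum -[(a%:R - y)^-1](average_cst m) averageB.
apply: (le_trans (modulus_average _ _)).
rewrite -[leRHS](average_cst m); apply: ler_average => w sw.
have spw : size (p ++ w) = size v by rewrite size_cat sw sp sv.
have h1 := circle_point_gap spw e1.
have a0 : agreement (p ++ w) v = 0%N.
  by move: av; rewrite /p; case: v {sv yv e1 h1 spw} => //= c v; case: ifP.
rewrite a0 expr0 in h1.
apply: (le_trans (inv_dist _ _ h1 ay)); [by []|by []|].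
have num : modulus (a%:R - y - (center R (p ++ w) - circle_point v e)) <= 8 * ratio ^+ k.+1.
  have -> : a%:R - y - (center R (p ++ w) - circle_point v e) =
    - (beta R ^+ k.+1 * center R w) + (- (y - center R v) + (circle_point v e - center R v)).
    by rewrite center_cat cp sp; ring.
  apply: (le_trans (modulus_triangle3 _ _ _)).
  rewrite !modulusN (circle_point_dist v e1) modulusM modulusX modulus_beta.
  have h2 := ratioX_le R (leq_addr m k.+1); rewrite -sv in h2.
  have h3 : ratio ^+ k.+1 * modulus (center R w) <= ratio ^+ k.+1 * 2.
    by rewrite ler_wpM2l ?modulus_center // ltW // ratioX_gt0.
  have := ratioX_gt0 R k.+1; move: yv h2 h3; rewrite /radius.
  set r := ratio ^+ size v; set s := ratio ^+ _.
  move: (s * _) (modulus _) => u t; lra.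
have := ratioX_gt0 R k.+1; move: num; set s := ratio ^+ _; lra.
Qed.

End energy.

(** * Rational functions with poles in the cells *)

Section rational.
Variable R : realType.
Local Notation C := (Cplx R).
Local Notation center := (center R).
Local Notation radius := (radius R).
Implicit Types (v w : seq bool) (n : nat).

Definition words n : seq (seq bool) := [seq tval t | t <- enum {: n.-tuple bool}].

Lemma mem_words n v : (v \in words n) = (size v == n).
Proof.
apply/mapP/eqP => [[t _ ->]|<-]; first by rewrite size_tuple.
by exists (in_tuple v); rewrite ?mem_enum.
Qed.

Lemma words_uniq n : uniq (words n).
Proof. by rewrite map_inj_uniq ?enum_uniq //; exact: val_inj. Qed.

Definition in_cell v (z : C) := modulus (z - center v) < radius (size v).

Definition poles_in_cells n (s : seq C) := all (fun a => has (in_cell^~ a) (words n)) s.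

Definition ratfun (P : {poly C}) (s : seq C) (z : C) := P.[z] / \prod_(a <- s) (z - a).

Lemma sum_count (T U : Type) (r : T -> U -> bool) (s : seq T) (t : seq U) :
  (\sum_(v <- t) count (r^~ v) s = \sum_(a <- s) count (r a) t)%N.
Proof.
elim: s => [|a s IH] /=; first by rewrite big_nil big1.
rewrite big_split /= IH big_cons; congr (_ + _)%N.
by rewrite -sum1_count [RHS]big_mkcond; apply: eq_bigr => i _; case: (r a i).
Qed.

Lemma count_cells_le1 n (z : C) : (count (in_cell^~ z) (words n) <= 1)%N.
Proof.
rewrite -size_filter.
have : uniq (seq.filter (in_cell^~ z) (words n)) by rewrite filter_uniq ?words_uniq.
have : all (in_cell^~ z) (seq.filter (in_cell^~ z) (words n)) by rewrite filter_all.
have : all (fun v => v \in words n) (seq.filter (in_cell^~ z) (words n)).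
  by apply/allP => v; rewrite mem_filter => /andP[].
case: (seq.filter _ _) => [|v [|w s]] //= /and3P[hv hw _] /and3P[vz wz _].
rewrite inE negb_or => /andP[/andP[/eqP []]].
move: hv hw; rewrite !mem_words => /eqP sv /eqP sw.
by apply: cells_disjoint vz wz; rewrite sv sw.
Qed.

Lemma in_cell_scaled v (z : C) :
  in_cell v z = (modulus ((z - center v) / ((radius (size v))%:C)%C) < 1).
Proof.
rewrite modulus_div modulus_real gtr0_norm ?radius_gt0 //.
by rewrite ltr_pdivrMr ?radius_gt0 // mul1r.
Qed.

Lemma prod_scaled v (e : C) (s : seq C) :
  let r : C := ((radius (size v))%:C)%C in
  \prod_(a <- s) (circle_point v e - a) =
  r ^+ size s * \prod_(a <- [seq (a - center v) / r | a <- s]) (e - a).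
Proof.
move=> r; have r0 : r != 0.
  by rewrite -modulus_gt0 modulus_real normr_gt0 gt_eqF // radius_gt0.
elim: s => [|a s IH] /=; first by rewrite !big_nil expr0 mulr1.
rewrite !big_cons exprS IH.
have -> : circle_point v e - a = r * (e - (a - center v) / r).
  by rewrite /circle_point -/r mulrBr mulrCA divff // mulr1; ring.
by ring.
Qed.

(** A rational function vanishing at infinity has fewer zeros than poles, while
    being nearly constant and nonzero on a circle forces as many zeros as poles
    inside. *)
Lemma ratfun_not_near_nonzero n (P : {poly C}) (s : seq C) (k : seq bool -> C) :
  poles_in_cells n s -> (size P <= size s)%N ->
  ~ forall v, size v = n -> k v != 0 /\ forall e, modulus e = 1 ->
    modulus (ratfun P s (circle_point v e) - k v) <= modulus (k v) / 2.
Proof.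
move=> sP szP h.
have P0 : P != 0.
  apply/eqP => P0; have [k0] := h (nseq n false) (size_nseq _ _).
  move=> /(_ 1 (modulus1 R)); rewrite /ratfun P0 horner0 mul0r sub0r modulusN.
  by apply/negP; rewrite -ltNge ltr_pdivrMr // ltr_pMr ?modulus_gt0 // ltr1n.
have [rs hrs] := closed_field_poly_normal P.
have sz : (size rs < size s)%N.
  by move: szP; rewrite hrs size_scale ?lead_coef_eq0 // size_prod_XsubC.
have cnt v : v \in words n -> (count (in_cell v) s <= count (in_cell v) rs)%N.
  rewrite mem_words => /eqP sv; have [k0 hk] := h v sv.
  set r : C := ((radius (size v))%:C)%C.
  have r0 : r != 0.
    by rewrite -modulus_gt0 modulus_real normr_gt0 gt_eqF // radius_gt0.
  have cE t : count (in_cell v) t =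
      count (fun a => modulus a < 1) [seq (a - center v) / r | a <- t].
    by rewrite count_map; apply: eq_count => a /=; rewrite in_cell_scaled.
  rewrite !cE.
  apply: (count_poles_le_zeros (l := lead_coef P * r ^+ size rs / r ^+ size s) k0).
  move=> e e1; have := hk e e1; rewrite /ratfun.
  have -> : P.[circle_point v e] = lead_coef P * \prod_(b <- rs) (circle_point v e - b).
    rewrite {1}hrs hornerZ horner_prod; congr (_ * _).
    by apply: eq_bigr => b _; rewrite hornerXsubC.
  rewrite !prod_scaled -/r invfM.
  set x := \prod_(a <- _) _; set y := \prod_(a <- _) _.
  by congr (modulus (_ - _) <= _); ring.
have : (\sum_(v <- words n) count (in_cell v) s <=
        \sum_(v <- words n) count (in_cell v) rs)%N.
  by rewrite big_seq [leqRHS]big_seq; apply: leq_sum.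
apply/negP; rewrite -ltnNge.
rewrite (sum_count (fun a v => in_cell v a)) (sum_count (fun a v => in_cell v a)).
apply: (@leq_ltn_trans (size rs)).
  by rewrite -sum1_size; apply: leq_sum => a _; exact: count_cells_le1.
apply: (leq_trans sz); rewrite -sum1_size big_seq [leqRHS]big_seq.
by apply: leq_sum => a /(allP sP); rewrite has_count.
Qed.

Lemma circle_point_notin n (s : seq C) v e : size v = n -> modulus e = 1 ->
  poles_in_cells n s -> circle_point v e \notin s.
Proof.
move=> sv e1 sP; apply/negP => /(allP sP)/hasP[w]; rewrite mem_words => /eqP sw.
apply/negP; rewrite /in_cell -leNgt modulusB.
have swv : size w = size v by rewrite sw sv.
apply: (le_trans _ (circle_point_gap swv e1)).
rewrite ler_pM2r ?invr_gt0 // ratioX_le //.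
have [->|/(agreement_lt swv)/ltnW] := eqVneq w v; first by rewrite agreement_refl.
by rewrite -swv.
Qed.

(** [F] is a rational function of value [c] at infinity with poles in the cells
    of level [n], away from these poles. *)
Definition cell_rational n (c : C) (F : C -> C) := exists (s : seq C) (P : {poly C}),
  [/\ poles_in_cells n s, (size P <= (size s).+1)%N, P`_(size s) = c &
      forall z, z \notin s -> F z = ratfun P s z].

Lemma size_prodXsubC (s : seq C) : size (\prod_(a <- s) ('X - a%:P)) = (size s).+1.
Proof. exact: (size_prod_XsubC s id). Qed.

Lemma horner_prodXsubC (s : seq C) z : (\prod_(a <- s) ('X - a%:P)).[z] = \prod_(a <- s) (z - a).
Proof. by rewrite horner_prod; apply: eq_bigr => a _; rewrite hornerXsubC. Qed.

Lemma prod_neq0 (s : seq C) z : z \notin s -> \prod_(a <- s) (z - a) != 0.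
Proof.
move=> zs; rewrite prodf_seq_neq0; apply/allP => a az /=; rewrite subr_eq0.
by apply: contraNneq zs => ->.
Qed.

Lemma coef_top_prod (P Q : {poly C}) m n : (size P <= m.+1)%N -> (size Q <= n.+1)%N ->
  (P * Q)`_(m + n) = P`_m * Q`_n.
Proof.
move=> hP hQ; rewrite coefM (bigD1 (inord m : 'I_(m + n).+1)) //= big1.
  by rewrite addr0 inordK ?addKn // ltnS leq_addr.
move=> i im; have : (i : nat) != m.
  by apply: contraNneq im => h; apply/eqP/val_inj; rewrite /= inordK // ltnS leq_addr.
rewrite neq_ltn => /orP[h|h]; last first.
  by rewrite nth_default ?mul0r // (leq_trans hP).
rewrite [Q`__]nth_default ?mulr0 // (leq_trans hQ) //.
by rewrite ltn_subRL ltn_add2r.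
Qed.

Lemma coef_prodXsubC (s : seq C) : (\prod_(a <- s) ('X - a%:P))`_(size s) = 1.
Proof.
have /monicP := monic_prod_XsubC s xpredT id.
by rewrite lead_coefE size_prodXsubC.
Qed.

Lemma cell_rational_ext n c F G : F =1 G -> cell_rational n c F -> cell_rational n c G.
Proof.
move=> FG [s [P [sP szP cP hP]]]; exists s, P; split=> // z zs.
by rewrite -FG hP.
Qed.

Lemma cell_rational_cst n c : cell_rational n c (fun=> c).
Proof.
exists [::], c%:P; split; rewrite ?coefC //; first exact: size_polyC_leq1.
by move=> z _; rewrite /ratfun hornerC big_nil divr1.
Qed.

Lemma cell_rationalD n c d F G : cell_rational n c F -> cell_rational n d G ->
  cell_rational n (c + d) (fun z => F z + G z).
Proof.
move=> [s [P [sP szP cP hP]]] [t [Q [tQ szQ dQ hQ]]].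
exists (s ++ t), (P * \prod_(a <- t) ('X - a%:P) + Q * \prod_(a <- s) ('X - a%:P)).
split.
- by rewrite /poles_in_cells all_cat; apply/andP.
- have hs (U : {poly C}) (u u' : seq C) : (size U <= (size u).+1)%N ->
      (size (U * \prod_(a <- u') ('X - a%:P))%R <= (size u + size u').+1)%N.
    move=> hU; apply: (leq_trans (size_polyMleq _ _)); rewrite size_prodXsubC addnS /=.
    by rewrite -addSn leq_add2r.
  apply: (leq_trans (size_polyD _ _)); rewrite geq_max size_cat hs //=.
  by rewrite addnC hs.
- rewrite coefD size_cat coef_top_prod ?size_prodXsubC // cP coef_prodXsubC mulr1.
  by rewrite addnC coef_top_prod ?size_prodXsubC // dQ coef_prodXsubC mulr1.
- move=> z; rewrite mem_cat negb_or => /andP[zs zt].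
  rewrite hP // hQ // /ratfun hornerD !hornerM !horner_prodXsubC big_cat /=.
  by field; rewrite !prod_neq0.
Qed.

Lemma cell_rationalM n c d F G : cell_rational n c F -> cell_rational n d G ->
  cell_rational n (c * d) (fun z => F z * G z).
Proof.
move=> [s [P [sP szP cP hP]]] [t [Q [tQ szQ dQ hQ]]].
exists (s ++ t), (P * Q); split.
- by rewrite /poles_in_cells all_cat; apply/andP.
- apply: (leq_trans (size_polyMleq _ _)); rewrite size_cat.
  by rewrite -subn1 leq_subLR add1n -addSn -addnS leq_add.
- by rewrite size_cat coef_top_prod // cP dQ.
- move=> z; rewrite mem_cat negb_or => /andP[zs zt].
  by rewrite hP // hQ // /ratfun hornerM big_cat /= invfM; ring.
Qed.

Lemma cell_rationalZ n c d F : cell_rational n d F -> cell_rational n (c * d) (fun z => c * F z).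
Proof. exact/cell_rationalM/cell_rational_cst. Qed.

Lemma cell_rational_pole n (a : C) : has (in_cell^~ a) (words n) ->
  cell_rational n 0 (fun z => (a - z)^-1).
Proof.
move=> ha; exists [:: a], (- 1)%:P; split; rewrite /poles_in_cells /= ?ha ?coefC //.
  exact: (leq_trans (size_polyC_leq1 _)).
move=> z; rewrite inE => za; rewrite /ratfun hornerC big_seq1 mulN1r -invrN opprB //.
Qed.

Lemma cell_rational_average n m (F : seq bool -> C -> C) :
  (forall w, size w = m -> cell_rational n 0 (F w)) ->
  cell_rational n 0 (fun z => average m (fun w => F w z)).
Proof.
elim: m F => [|m IH] F hF /=; first exact: hF.
have h b : cell_rational n 0 (fun z => average m (fun w => F (b :: w) z)).
  by apply: (IH (fun w => F (b :: w))) => w sw; apply: hF; rewrite /= sw.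
have := cell_rationalZ 2^-1 (cell_rationalD (h false) (h true)).
rewrite addr0 mulr0; apply: cell_rational_ext => z.
by rewrite mulrC.
Qed.

(** The poles are the centres of the cells below [p]. *)
Lemma cell_rational_cauchy p m : cell_rational (size p + m) 0 (cauchy_sum p m).
Proof.
apply: cell_rational_average => w sw; apply: cell_rational_pole.
apply/hasP; exists (p ++ w); first by rewrite mem_words size_cat sw.
by rewrite /in_cell subrr modulus0 radius_gt0.
Qed.

(** The coefficient of [1 / z] at infinity of a discretised Cauchy transform is
    minus its mass. *)
Lemma cell_rational_cauchy_shift p m :
  cell_rational (size p + m) (- 1) (fun z => z * cauchy_sum p m z).
Proof.
have h w : size w = m ->
    cell_rational (size p + m) 0 (fun z => 1 + z * (center (p ++ w) - z)^-1).
  move=> sw.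
  have hw : has (in_cell^~ (center (p ++ w))) (words (size p + m)).
    apply/hasP; exists (p ++ w); first by rewrite mem_words size_cat sw.
    by rewrite /in_cell subrr modulus0 radius_gt0.
  exists [:: center (p ++ w)], (- center (p ++ w))%:P; split.
  - by rewrite /poles_in_cells /= hw.
  - exact: (leq_trans (size_polyC_leq1 _)).
  - by rewrite coefC.
  - move=> z; rewrite inE => za; rewrite /ratfun hornerC big_seq1.
    by field; rewrite !subr_eq0 za eq_sym za.
have := cell_rationalD (cell_rational_cst (size p + m) (- 1)) (cell_rational_average h).
rewrite addr0; apply: cell_rational_ext => z.
rewrite -averageZ addrC -[X in _ - X](average_cst m) averageB.
by apply: eq_average => w _; rewrite addrC addKr.
Qed.

End rational.

(** * Continuous complex functions *)

Section complex_continuity.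
Variable R : realType.
Local Notation C := (Cplx R).

Lemma ball_modulus (x y : C) (e : R) : ball x ((e%:C)%C : R[i]) y <-> modulus (x - y) < e.
Proof. by rewrite -ball_normE /ball_ /= normE ltcR. Qed.

Lemma cplx_continuousP (X : topologicalType) (F : X -> C) :
  continuous F <->
  forall x (e : R), 0 < e -> \forall y \near x, modulus (F x - F y) < e.
Proof.
split=> [cF x e e0|h x].
  have e0' : 0 < ((e%:C)%C : R[i]) by rewrite ltcR.
  have /cvgrPdist_lt/(_ _ e0') := cF x.
  by apply: filterS => y; rewrite normE ltcR.
apply/cvgrPdist_lt => e e0.
have eE : e = ((complex.Re e)%:C)%C by rewrite RRe_real // gtr0_real.
have : 0 < complex.Re e by rewrite -ltcR -eE.
by move=> /(h x); apply: filterS => y; rewrite [in X in _ -> X]eE normE ltcR.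
Qed.

Lemma real_continuousP (X : topologicalType) (F : X -> R) :
  continuous F <->
  forall x (e : R), 0 < e -> \forall y \near x, `|F x - F y| < e.
Proof.
by split=> [cF x e e0|h x]; [have /cvgrPdist_lt := cF x; exact|apply/cvgrPdist_lt/h].
Qed.

Lemma uclosureP (X : choiceType) (A : set (X -> C)) (f : X -> C) :
  uclosure A f <->
  forall e : R, 0 < e -> exists2 g, A g & forall x, modulus (f x - g x) < e.
Proof.
rewrite /uclosure; split=> [cl e e0|h B].
  have e0' : 0 < ((e%:C)%C : R[i]) by rewrite ltcR.
  have [|g [Ag hg]] := cl [set g | forall x, ball (f x) ((e%:C)%C : R[i]) (g x)].
    apply/uniform_nbhs; exists [set xy | ball xy.1 ((e%:C)%C : R[i]) xy.2].
    by split; [exact: entourage_ball (PosNum e0')|move=> g /= hg x; exact: hg].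
  by exists g => // x; apply/ball_modulus; exact: hg.
move=> /uniform_nbhs[E [entE sub]].
have [e /= e0 he] : exists2 e : R[i], 0 < e & [set xy | ball xy.1 e xy.2] `<=` E.
  by move: entE; rewrite -entourage_ballE => -[e e0 he]; exists e.
have eE : e = ((complex.Re e)%:C)%C by rewrite RRe_real // gtr0_real.
have [g Ag hg] : exists2 g, A g & forall x, modulus (f x - g x) < complex.Re e.
  by apply: h; rewrite -ltcR -eE.
exists g; split=> //; apply: sub => x _; apply: he => /=.
by rewrite eE; apply/ball_modulus.
Qed.

Lemma continuous_of_Re_Im (X : topologicalType) (u v : X -> R) :
  continuous u -> continuous v -> continuous (fun x => Complex (u x) (v x) : C).
Proof.
move=> /real_continuousP cu /real_continuousP cv; apply/cplx_continuousP => x e e0.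
have e2 : 0 < e / 2 by rewrite divr_gt0.
near=> y; apply: (le_lt_trans (modulus_le_ReIm _)) => /=.
have h1 : `|u x - u y| < e / 2 by near: y; exact: cu.
have h2 : `|v x - v y| < e / 2 by near: y; exact: cv.
by rewrite (splitr e) ltrD.
Unshelve. all: by end_near. Qed.

Section maps.
Variables (X : topologicalType) (F G : X -> C).
Hypotheses (cF : continuous F) (cG : continuous G).

Lemma continuous_Re : continuous (fun x => complex.Re (F x)).
Proof.
move/cplx_continuousP: cF => h; apply/real_continuousP => x e /(h x).
by apply: filterS => y; apply: le_lt_trans; rewrite -ReB Re_le_modulus.
Qed.

Lemma continuous_Im : continuous (fun x => complex.Im (F x)).
Proof.
move/cplx_continuousP: cF => h; apply/real_continuousP => x e /(h x).
by apply: filterS => y; apply: le_lt_trans; rewrite -ImB Im_le_modulus.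
Qed.

Lemma continuous_modulus : continuous (fun x => modulus (F x)).
Proof.
move/cplx_continuousP: cF => h; apply/real_continuousP => x e /(h x).
apply: filterS => y; apply: le_lt_trans; rewrite ler_norml.
rewrite modulus_lower andbT lerNl opprB.
by rewrite (le_trans (modulus_lower _ _)) // modulusB.
Qed.

Lemma continuous_conj : continuous (fun x => ((F x)^*)%C : C).
Proof.
move/cplx_continuousP: cF => h; apply/cplx_continuousP => x e /(h x).
by apply: filterS => y; rewrite -rmorphB modulus_conj.
Qed.

Lemma continuousDc : continuous (fun x => F x + G x).
Proof. by move=> x; apply: cvgD; [exact: cF|exact: cG]. Qed.

Lemma continuousNc : continuous (fun x => - F x).
Proof. by move=> x; apply: cvgN; exact: cF. Qed.

Lemma continuousMc : continuous (fun x => F x * G x).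
Proof.
move/cplx_continuousP: cF => hF; move/cplx_continuousP: cG => hG.
apply/cplx_continuousP => x e e0.
have [d d0 hd] := modulus_mul_close (modulus_ge0 (F x)) (modulus_ge0 (G x)) e0.
apply: filterS2 (hF x d d0) (hG x d d0) => y h1 h2.
by rewrite modulusB; apply: hd; rewrite // modulusB.
Qed.

End maps.

Lemma continuous_cstc (X : topologicalType) (c : C) : continuous (fun _ : X => c).
Proof. by move=> x; exact: cvg_cst. Qed.

Lemma continuous_real_complex (X : topologicalType) (u : X -> R) :
  continuous u -> continuous (fun x => ((u x)%:C)%C : C).
Proof.
move=> cu; have c0 : continuous (fun _ : X => 0 : R) by move=> x; exact: cvg_cst.
exact: (continuous_of_Re_Im cu c0).
Qed.

Lemma continuous_uniform_limit (X : topologicalType) (f : X -> C) :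
  (forall e : R, 0 < e ->
    exists2 g : X -> C, continuous g & forall x, modulus (f x - g x) < e) ->
  continuous f.
Proof.
move=> h; apply/cplx_continuousP => x e e0.
have e3 : 0 < e / 3 by rewrite divr_gt0.
have [g /cplx_continuousP cg hg] := h _ e3.
near=> y.
have h1 : modulus (g x - g y) < e / 3 by near: y; exact: cg.
have -> : f x - f y = (f x - g x) + ((g x - g y) + - (f y - g y)) by ring.
apply: (le_lt_trans (modulus_triangle3 _ _ _)); rewrite modulusN.
by have := hg x; have := hg y; move: h1; lra.
Unshelve. all: by end_near. Qed.

Section compact_space.
Variable J : topologicalType.
Hypotheses (compactJ : compact [set: J]) (hausdorffJ : hausdorff_space J).

Let normalJ : normal_space J := compact_normal hausdorffJ compactJ.

Lemma closed_compactJ (K : set J) : closed K -> compact K.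
Proof. by move=> cK; apply: subclosed_compact cK compactJ _. Qed.

Lemma urysohn_function (A B : set J) : closed A -> closed B -> A `&` B = set0 ->
  exists u : J -> R, [/\ continuous u, forall x, 0 <= u x <= 1,
    forall x, A x -> u x = 0 & forall x, B x -> u x = 1].
Proof.
move=> cA cB AB; have sep := normal_uniform_separator normalJ cA cB AB.
exists (Urysohn A B); split.
- exact: Urysohn_continuous.
- move=> x; have : range (@Urysohn _ R A B) (Urysohn A B x) by exists x.
  by move/Urysohn_range; rewrite /= in_itv.
- by move=> x Ax; apply: (Urysohn_sub0 sep); exists x.
- by move=> x Bx; apply: (Urysohn_sub1 sep); exists x.
Qed.

Lemma within_continuous_bounded (K : set J) (f : J -> R) : closed K ->
  {within K, continuous f} -> exists2 M, 0 < M & forall x, K x -> `|f x| <= M.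
Proof.
move=> /closed_compactJ cK cf.
have /compact_bounded : compact (f @` K) by exact: continuous_compact.
move=> [M [_ hM]]; exists (`|M| + 1); first by rewrite ltr_wpDl.
move=> x Kx; apply: (hM (`|M| + 1)); last by exists x.
by rewrite (le_lt_trans (ler_norm _)) // ltrDl.
Qed.

Lemma modulus_bounded (K : set J) (F : J -> C) : closed K -> continuous F ->
  exists2 M : R, 0 < M & forall x, K x -> modulus (F x) <= M.
Proof.
move=> cK cF; have [|M M0 hM] := within_continuous_bounded (f := fun x => modulus (F x)) cK.
  exact/continuous_subspaceT/continuous_modulus.
by exists M => // x /hM; rewrite ger0_norm.
Qed.

Lemma tietze_complex (K : set J) (f : J -> C) : closed K ->
  {within K, continuous f} ->
  exists2 F : J -> C, continuous F & forall x, K x -> F x = f x.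
Proof.
move=> cK cf.
have cre : {within K, continuous (fun x => complex.Re (f x))} by exact: continuous_Re.
have cim : {within K, continuous (fun x => complex.Im (f x))} by exact: continuous_Im.
have ext (u : J -> R) : {within K, continuous u} ->
    exists2 U : J -> R, continuous U & forall x, K x -> U x = u x.
  move=> cu; have [M M0 hM] := within_continuous_bounded cK cu.
  have [U [hU cU _]] := continuous_bounded_extension normalJ cK M0 cu hM.
  by exists U => // x Kx; rewrite hU // inE.
have [U cU hU] := ext _ cre; have [V cV hV] := ext _ cim.
exists (fun x => Complex (U x) (V x)); first exact: continuous_of_Re_Im.
by move=> x Kx; rewrite hU // hV //; case: (f x).
Qed.

Lemma within_cplx_continuousP (K : set J) (f : J -> C) :
  (forall x (e : R), K x -> 0 < e ->
    exists2 U, nbhs x U & forall y, U y -> K y -> modulus (f x - f y) < e) ->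
  {within K, continuous f}.
Proof.
move=> h; apply/subspace_sigL_continuousP/cplx_continuousP => -[x Kx] e e0.
have [|U nU hU] := h x e _ e0; first by move: Kx; rewrite inE.
have nU' := @initial_continuous K J set_val (exist _ x Kx) U nU.
apply: (@filterS _ (nbhs (exist _ x Kx : K)) _ _ _ _ nU') => -[y Ky] /= Uy; apply: hU => //.
exact: set_mem Ky.
Qed.

End compact_space.

End complex_continuity.

(** * Functions on a Cantor set with rational approximants off it *)

Lemma compact_accumulation (J : topologicalType) (K : set J) (x_ : nat -> J) : compact K ->
  (forall n, K (x_ n)) ->
  exists2 x, K x & forall U N, nbhs x U -> exists2 n, (N <= n)%N & U (x_ n).
Proof.
move=> cK hx; have [|x [Kx clx]] := cK (x_ @ \oo) _; first by exists 0%N => // n _; exact: hx.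
exists x => // U N nU.
have [|y [[n Nn <-] Uy]] := clx (x_ @` [set n | (N <= n)%N]) U _ nU.
  by exists N => // n Nn; exists n.
by exists n.
Qed.

Lemma avoided_value (R : realType) (J : topologicalType) (K : set J) (F : J -> Cplx R)
    (c : Cplx R) : compact K -> continuous F -> (forall x, K x -> F x != c) ->
  exists2 d : R, 0 < d & forall x, K x -> d <= modulus (F x - c).
Proof.
move=> cK cF hF; apply: contrapT => h.
have /choice[x_ hx] : forall n, exists x, K x /\ modulus (F x - c) < n.+1%:R^-1.
  move=> n; apply: contrapT => h'; apply: h; exists n.+1%:R^-1; first by rewrite invr_gt0.
  by move=> x Kx; rewrite leNgt; apply/negP => hx; apply: h'; exists x.
have [|x Kx acc] := @compact_accumulation J K x_ cK.
  by move=> n; have [] := hx n.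
have d0 : 0 < modulus (F x - c) / 2 by rewrite divr_gt0 // modulus_gt0 subr_eq0 hF.
have [N hN] : exists N, N.+1%:R^-1 < modulus (F x - c) / 2.
  have [N _ hN] := near_infty_natSinv_lt (PosNum d0).
  by exists N; exact: hN (leqnn _).
have [n Nn hn] := acc _ N ((cplx_continuousP F).1 cF x _ d0).
have [_ h1] := hx n.
have h2 : n.+1%:R^-1 <= N.+1%:R^-1 :> R by rewrite lef_pV2 ?posrE // ler_nat.
have := modulus_dist (F x) (F (x_ n)) c; move: hn h1 h2 hN => /=.
by move: (n.+1%:R^-1) (N.+1%:R^-1) => u w; lra.
Qed.

(** A homeomorphism of [L] with the space of binary sequences, as its digits. *)
Record coding (J : topologicalType) (L : set J) (sigma : J -> nat -> bool) : Prop := {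
  coding_closed : forall k b, closed (L `&` [set x | sigma x k = b]);
  coding_inj : forall x y, L x -> L y -> sigma x =1 sigma y -> x = y;
  coding_onto : forall v : seq bool, exists2 x, L x & mkseq (sigma x) (size v) = v }.
Arguments coding_closed {J L sigma} _ k b [t] _.

Section coded.
Variables (R : realType) (J : topologicalType).
Hypotheses (compactJ : compact [set: J]) (hausdorffJ : hausdorff_space J).
Variables (L : set J) (sigma : J -> nat -> bool).
Hypothesis coded : coding L sigma.
Local Notation C := (Cplx R).
Local Notation ratio := (ratio R).

Definition address x n : seq bool := mkseq (sigma x) n.

Lemma addressE x n : address x n = mkseq (sigma x) n. Proof. by []. Qed.

Lemma size_address x n : size (address x n) = n. Proof. exact: size_mkseq. Qed.

Lemma address_rcons x n : address x n.+1 = rcons (address x n) (sigma x n).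
Proof. by rewrite /address /mkseq -addn1 iotaD map_cat cats1. Qed.

Lemma address_eqP x y n :
  address x n = address y n <-> forall k, (k < n)%N -> sigma x k = sigma y k.
Proof.
split=> [h k kn|h].
  by have := congr1 (fun s => nth false s k) h; rewrite !nth_mkseq.
by apply/eq_in_map => k; rewrite mem_iota => /h.
Qed.

Lemma closed_coded : closed L.
Proof.
have -> : L = (L `&` [set x | sigma x 0%N = true]) `|`
              (L `&` [set x | sigma x 0%N = false]).
  apply/seteqP; split=> [x Lx|x [] []//].
  by case E : (sigma x 0%N); [left|right]; split.
by apply: closedU; exact: (coding_closed coded).
Qed.

Lemma digit_near x k : L x -> \forall y \near x, L y -> sigma y k = sigma x k.
Proof.
move=> Lx; have o := closed_openC (coding_closed coded k (~~ sigma x k)).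
have : nbhs x (~` (L `&` [set y | sigma y k = ~~ sigma x k])).
  by apply: open_nbhs_nbhs; split=> // -[_] /=; case: (sigma x k).
apply: filterS => y hy Ly; apply: contrapT => h; apply: hy; split=> //=.
by case: (sigma y k) (sigma x k) h => [] [].
Qed.

Lemma cell_near x n : L x -> \forall y \near x, L y -> address y n = address x n.
Proof.
move=> Lx; elim: n => [|n IH]; first by apply: nearW.
apply: filterS2 (digit_near n Lx) IH => y hd hn Ly.
by rewrite !address_rcons hd ?hn.
Qed.

Lemma compact_coded : compact L.
Proof. exact: closed_compactJ closed_coded. Qed.

(** Points with more and more digits of [x] accumulate at a point with all its digits. *)
Lemma cell_small x U : L x -> nbhs x U ->
  exists n, forall y, L y -> address y n = address x n -> U y.
Proof.
move=> Lx nU; apply: contrapT => h.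
have /choice[y_ hy] : forall n, exists y, [/\ L y, address y n = address x n & ~ U y].
  move=> n; apply: contrapT => h'; apply: h; exists n => y Ly yx.
  by apply: contrapT => nUy; apply: h'; exists y.
have [|y Ly acc] := @compact_accumulation _ L y_ compact_coded.
  by move=> n; have [] := hy n.
have yx : y = x.
  apply: (coding_inj coded) => // k.
  have [n kn /=] := acc _ k.+1 (digit_near k Ly).
  have [Lyn ynx _] := hy n => /(_ Lyn) <-.
  by move/address_eqP : ynx; apply.
have nUy : nbhs y U by rewrite yx.
have [n _] := acc U 0%N nUy.
by have [_ _] := hy n.
Qed.

Lemma uniform_on_cells (F : J -> C) (e : R) : continuous F -> 0 < e ->
  exists N, forall n x y, (N <= n)%N -> L x -> L y -> address x n = address y n ->
    modulus (F x - F y) < e.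
Proof.
move=> /cplx_continuousP cF e0; have e2 : 0 < e / 2 by rewrite divr_gt0.
apply: contrapT => h.
have /choice[p hp] : forall n, exists p : J * J, [/\ L p.1, L p.2,
    address p.1 n = address p.2 n & e <= modulus (F p.1 - F p.2)].
  move=> N; apply: contrapT => h'; apply: h; exists N => n x y Nn Lx Ly xy.
  rewrite ltNge; apply/negP => he; apply: h'; exists (x, y); split=> //=.
  by apply/address_eqP => k kN; move/address_eqP : xy; apply; exact: leq_trans Nn.
have [|x Lx acc] := @compact_accumulation _ L (fun n => (p n).1) compact_coded.
  by move=> n; have [] := hp n.
have [m hm] := cell_small Lx (cF x _ e2).
have [n mn hn] := acc _ m (cell_near m Lx).
have [L1 L2 a12 he] := hp n.
have /= h1 := hm _ L1 (hn L1).
have h2 : modulus (F x - F (p n).2) < e / 2.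
  apply: hm => //; rewrite -(hn L1); apply/address_eqP => k km.
  by move/address_eqP : a12 => ->//; exact: leq_trans mn.
have := modulus_dist (F (p n).1) (F x) (F (p n).2).
rewrite (modulusB _ (F x)); move: h1 h2 he; lra.
Qed.

(** Stands for: [F] extends continuously from [L] to the Riemann sphere,
    holomorphically off the planar Cantor set, with value [c] at infinity. *)
Definition approximable (F : J -> C) (c : C) := forall e : R, 0 < e ->
  exists N, forall n, (N <= n)%N -> exists2 G, cell_rational n c G &
    forall x z, L x -> modulus z = 1 ->
      modulus (G (circle_point (address x n) z) - F x) < e.

Lemma approximable_eq F F' c : (forall x, L x -> F x = F' x) ->
  approximable F c -> approximable F' c.
Proof.
move=> FF aF e /aF[N hN]; exists N => n /hN[G gP hG]; exists G => // x z Lx z1.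
by rewrite -FF //; exact: hG.
Qed.

Lemma approximable_cst c : approximable (fun=> c) c.
Proof.
move=> e e0; exists 0%N => n _; exists (fun=> c); first exact: cell_rational_cst.
by move=> x z _ _; rewrite subrr modulus0.
Qed.

Lemma approximableD F F' c c' : approximable F c -> approximable F' c' ->
  approximable (fun x => F x + F' x) (c + c').
Proof.
move=> aF aF' e e0; have e2 : 0 < e / 2 by rewrite divr_gt0.
have [N hN] := aF _ e2; have [N' hN'] := aF' _ e2.
exists (maxn N N') => n; rewrite geq_max => /andP[/hN[G gP hG] /hN'[G' gP' hG']].
exists (fun z => G z + G' z); first exact: cell_rationalD.
move=> x z Lx z1; have := hG x z Lx z1; have := hG' x z Lx z1.
set y := circle_point _ _ => h1 h2.
have -> : G y + G' y - (F x + F' x) = (G y - F x) + (G' y - F' x) by ring.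
by apply: (le_lt_trans (modulus_triangle _ _)); move: h1 h2; lra.
Qed.

Lemma approximableM F F' c c' : continuous F -> continuous F' ->
  approximable F c -> approximable F' c' ->
  approximable (fun x => F x * F' x) (c * c').
Proof.
move=> cF cF' aF aF' e e0.
have [M M0 hM] := modulus_bounded compactJ closed_coded cF.
have [M' M0' hM'] := modulus_bounded compactJ closed_coded cF'.
have [d d0 hd] := modulus_mul_close (ltW M0) (ltW M0') e0.
have [N hN] := aF _ d0; have [N' hN'] := aF' _ d0.
exists (maxn N N') => n; rewrite geq_max => /andP[/hN[G gP hG] /hN'[G' gP' hG']].
exists (fun z => G z * G' z); first exact: cell_rationalM.
by move=> x z Lx z1; apply: hd; rewrite ?hM ?hM' ?hG ?hG'.
Qed.

Lemma approximableZ F c c' : approximable F c -> approximable (fun x => c' * F x) (c' * c).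
Proof.
move=> aF e e0; have K0 : 0 < 1 + modulus c' by rewrite ltr_pwDl.
have [N hN] := aF (e / (1 + modulus c')) (divr_gt0 e0 K0).
exists N => n /hN[G gP hG]; exists (fun z => c' * G z); first exact: cell_rationalZ.
move=> x z Lx z1; have := hG x z Lx z1; rewrite ltr_pdivlMr // => h.
rewrite -mulrBr modulusM; apply: le_lt_trans h.
by rewrite mulrC ler_wpM2l // lerDr.
Qed.

(** If [F] avoided [c] on [L], a fine approximant minus [c] would vanish at infinity and
    be nearly a nonzero constant on each circle, as [F] is nearly constant on cells. *)
Lemma approximable_value F c : continuous F -> approximable F c ->
  exists2 x, L x & F x = c.
Proof.
move=> cF aF; apply: contrapT => h.
have [|d d0 hd] := avoided_value (c := c) compact_coded cF.
  by move=> x Lx; apply/eqP => Fx; apply: h; exists x.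
have d8 : 0 < d / 8 by rewrite divr_gt0.
have [N hN] := aF _ d8; have [N' hN'] := uniform_on_cells cF d8.
have [G [s [P [sP szP cP hP]]] hG] := hN (maxn N N') (leq_maxl _ _).
set n := maxn N N' in sP hG *.
have /choice[xv hxv] : forall v, exists x, L x /\ address x (size v) = v.
  by move=> v; have [x Lx hx] := coding_onto coded v; exists x.
apply: (@ratfun_not_near_nonzero R n (P - c *: \prod_(a <- s) ('X - a%:P)) s
   (fun v => F (xv v) - c) sP).
  have [->|nz] := eqVneq (P - c *: \prod_(a <- s) ('X - a%:P)) 0.
    by rewrite size_poly0.
  apply/leq_sizeP => j; rewrite leq_eqVlt => /orP[/eqP <-|hj].
    by rewrite coefB coefZ coef_prodXsubC cP mulr1 subrr.
  rewrite coefB coefZ !nth_default ?mulr0 ?subrr // ?size_prodXsubC //.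
  exact: (leq_trans szP).
move=> v sv; have [Lx xvE] := hxv v; have hdx := hd _ Lx.
split; first by rewrite -modulus_gt0 (lt_le_trans d0).
move=> e e1.
have zs := circle_point_notin sv e1 sP.
rewrite /ratfun hornerD hornerN hornerZ horner_prodXsubC mulrBl mulfK ?prod_neq0 //.
have := hG _ e Lx e1; rewrite -{1}sv xvE hP // /ratfun.
set q := _ / _.
have -> : q - c - (F (xv v) - c) = q - F (xv v) by ring.
move: hdx d0; lra.
Qed.

Lemma approximable_unique F c c' : continuous F ->
  approximable F c -> approximable F c' -> c = c'.
Proof.
move=> cF aF aF'; have := approximableD aF (approximableZ (- 1) aF').
have c0 : continuous (fun x => F x + -1 * F x).
  apply: continuousDc => //; apply: continuousMc => //; exact: continuous_cstc.
move=> /(approximable_value c0)[x _]; rewrite !mulN1r subrr => /eqP.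
by rewrite eq_sym subr_eq0 => /eqP.
Qed.

(** The values at infinity of the approximating functions are values on [L], so they
    have a limit by compactness of [L]. *)
Lemma approximable_limit F : continuous F ->
  (forall e : R, 0 < e -> exists (G : J -> C) c, [/\ continuous G, approximable G c &
     forall x, L x -> modulus (F x - G x) < e]) ->
  exists c, approximable F c.
Proof.
move=> cF h.
have h' n : exists Gcx : (J -> C) * C * J, [/\ L Gcx.2, approximable Gcx.1.1 Gcx.1.2,
    Gcx.1.1 Gcx.2 = Gcx.1.2 & forall x, L x -> modulus (F x - Gcx.1.1 x) < n.+1%:R^-1].
  have [|G [c [cG aG hG]]] := h n.+1%:R^-1; first by rewrite invr_gt0.
  by have [x Lx xc] := approximable_value cG aG; exists (G, c, x).
have /choice[g hg] := h'.
have [|x Lx acc] := @compact_accumulation _ L (fun n => (g n).2) compact_coded.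
  by move=> n; have [] := hg n.
exists (F x) => e e0; have e8 : 0 < e / 8 by rewrite divr_gt0.
have [N _ hN] := near_infty_natSinv_lt (PosNum e8).
have [k Nk hk] := acc _ N ((cplx_continuousP F).1 cF x _ e8).
have {hN Nk} : k.+1%:R^-1 < e / 8 :> R by exact: hN.
have := hg k; move: (k.+1%:R^-1) => ek {}hg hNk.
case: (g k) hg hk => -[G c] y /= [Ly aG Gy hG] hk.
have cx : modulus (F x - c) < e / 4.
  have := modulus_dist (F x) (F y) c; rewrite -{2}Gy; have := hG y Ly; move: hk hNk; lra.
have [M hM] := aG _ e8; exists M => n /hM[Q qP hQ].
exists (fun z => Q z + (F x - c)).
  have := cell_rationalD qP (cell_rational_cst n (F x - c)).
  by rewrite addrC subrK.
move=> u z Lu z1; have := hQ u z Lu z1; have := hG u Lu.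
set q := circle_point _ _ => h1 h2.
have -> : Q q + (F x - c) - F u = (Q q - G u) + (- (F u - G u) + (F x - c)) by ring.
apply: (le_lt_trans (modulus_triangle3 _ _ _)); rewrite modulusN.
by move: h1 h2 cx hNk; lra.
Qed.

Lemma real_limit (a B : nat -> R) :
  (forall m n, `|a m - a n| <= B m + B n) -> exists l, forall n, `|l - a n| <= B n.
Proof.
move=> h; pose S := [set a n - B n | n in [set: nat]].
have ub m : ubound S (a m + B m).
  by move=> _ [n _ <-]; have := h m n; rewrite ler_norml => /andP[]; lra.
have S0 : S !=set0 by exists (a 0%N - B 0%N); exists 0%N.
exists (sup S) => n; rewrite ler_norml.
have h1 : a n - B n <= sup S.
  by apply: ub_le_sup; [exists (a 0%N + B 0%N); exact: ub|exists n].
have h2 : sup S <= a n + B n by exact: ge_sup.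
by apply/andP; split; move: h1 h2; lra.
Qed.

(** The limit is continuous on [L] because functions of the first digits are locally
    constant there; Tietze's theorem extends it. *)
Lemma address_limit (g : seq bool -> C) (K q : R) (N : nat) : 0 <= K -> 0 <= q < 1 ->
  (forall v a, (N <= size v)%N -> modulus (g v - g (rcons v a)) <= K * q ^+ size v) ->
  exists2 F : J -> C, continuous F &
    forall x n, L x -> (N <= n)%N ->
      modulus (F x - g (address x n)) <= 2 * (K / (1 - q) * q ^+ n).
Proof.
move=> K0 /andP[q0 q1] hg; have q1' : 0 < 1 - q by rewrite subr_gt0.
pose B n := K / (1 - q) * q ^+ n.
have B0 n : 0 <= B n by rewrite mulr_ge0 ?exprn_ge0 // divr_ge0 // ltW.
have BS n : K * q ^+ n + B n.+1 = B n.
  by rewrite /B exprS; field; rewrite gt_eqF.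
have tele x m n : (N <= n)%N ->
    modulus (g (address x n) - g (address x (n + m))) <= B n - B (n + m)%N.
  move=> Nn; elim: m => [|m IH]; first by rewrite addn0 !subrr modulus0.
  have := hg (address x (n + m)) (sigma x (n + m)).
  rewrite -address_rcons size_address => /(_ (leq_trans Nn (leq_addr _ _))) h.
  have := modulus_dist (g (address x n)) (g (address x (n + m))) (g (address x (n + m).+1)).
  by rewrite addnS; have := BS (n + m)%N; move: IH h; lra.
have dist x m n : (N <= m)%N -> (N <= n)%N ->
    modulus (g (address x m) - g (address x n)) <= B m + B n.
  wlog mn : m n / (m <= n)%N.
    move=> H Nm Nn; have /orP[mn|nm] := leq_total m n; first exact: H.
    by rewrite modulusB [leRHS]addrC; exact: H.
  by move=> Nm _; rewrite -(subnKC mn); have := tele x (n - m)%N m Nm;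
    have := B0 (m + (n - m))%N; lra.
have /choice[f hf] : forall x, exists l : C, forall n, (N <= n)%N ->
    modulus (l - g (address x n)) <= 2 * B n.
  move=> x; pose a n := g (address x (N + n)).
  have aB m n : modulus (a m - a n) <= B (N + m)%N + B (N + n)%N.
    by apply: dist; exact: leq_addr.
  have [m n|l hl] := @real_limit (fun n => complex.Re (a n)) (fun n => B (N + n)%N).
    by rewrite -ReB (le_trans (Re_le_modulus _)).
  have [m n|l' hl'] := @real_limit (fun n => complex.Im (a n)) (fun n => B (N + n)%N).
    by rewrite -ImB (le_trans (Im_le_modulus _)).
  exists (Complex l l') => n Nn; rewrite -(subnKC Nn).
  have := hl (n - N)%N; have := hl' (n - N)%N; rewrite /a.
  have := modulus_le_ReIm (Complex l l' - g (address x (N + (n - N)))).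
  by rewrite ReB ImB /=; lra.
have [|F cF hF] := @tietze_complex R J compactJ hausdorffJ L f closed_coded.
  apply: within_cplx_continuousP => x e Lx e0.
  have K1 : 0 < 1 + 4 * (K / (1 - q)).
    by rewrite ltr_pwDl // mulr_ge0 // divr_ge0 // ltW.
  have [||k hk] := @exp_small R q (e / (1 + 4 * (K / (1 - q)))).
  - by rewrite q0.
  - by rewrite divr_gt0.
  have hk' : q ^+ maxn N k < e / (1 + 4 * (K / (1 - q))).
    by apply: le_lt_trans hk; rewrite ler_wiXn2l ?leq_maxr // ltW.
  exists [set y | L y -> address y (maxn N k) = address x (maxn N k)].
    exact: cell_near.
  move=> y /= hy Ly.
  have h1 := hf x _ (leq_maxl N k); have h2 := hf y _ (leq_maxl N k).
  rewrite (hy Ly) in h2.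
  have := modulus_dist (f x) (g (address x (maxn N k))) (f y).
  rewrite (modulusB (g _)); move: h1 h2 hk'; rewrite ltr_pdivlMr // /B.
  have : 0 <= q ^+ maxn N k by rewrite exprn_ge0.
  set Q := q ^+ _; set K' := K / _; lra.
by exists F => // x n Lx Nn; rewrite hF //; exact: hf.
Qed.

(** The coding of [L] by a planar Cantor set, extended to the whole space. *)
Lemma exists_planar_map : exists2 F : J -> C, continuous F &
  forall x n, L x -> modulus (F x - center R (address x n)) <= 5 * ratio ^+ n.
Proof.
have [|v a _|F cF hF] := @address_limit (center R) 1 ratio 0%N ler01.
- by rewrite ltW ?ratio_gt0 // ratio_lt1.
- by rewrite mul1r modulusB center_rcons_dist.
exists F => // x n Lx; have := hF x n Lx isT.
by congr (_ <= _); rewrite mulrA; congr (_ * _); rewrite /ratio; field.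
Qed.

(** Restricted to [L], this is the Cauchy transform of the Bernoulli measure on the cell
    [p], composed with the coding. *)
Lemma exists_cauchy_transform p : exists F : J -> C, exists K : R,
  [/\ continuous F, 0 <= K & forall m x z, L x -> modulus z = 1 ->
     modulus (cauchy_sum p m (circle_point (address x (size p + m)) z) - F x)
       <= K * (5 / 6) ^+ m].
Proof.
set k := size p; set A := 192 * (5 / 3) ^+ k : R.
have A0 : 0 <= A by rewrite mulr_ge0 // exprn_ge0 // divr_ge0.
set D := A * (6 / 5) ^+ k.
have [|||F cF hF] := @address_limit
  (fun v => cauchy_sum p (size v - k) (circle_point v 1)) D (5 / 6) k.
- by rewrite mulr_ge0 // exprn_ge0 // divr_ge0.
- by apply/andP; split; lra.
- move=> v a kv; have -> : (size (rcons v a) - k = (size v - k).+1)%N.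
    by rewrite size_rcons subSn.
  have := @cauchy_sum_step R p (size v - k) v a 1 1.
  rewrite subnKC // => /(_ erefl (modulus1 R) (modulus1 R)) h.
  apply: (le_trans h); rewrite -/k -/A /D -mulrA ler_wpM2l //.
  rewrite -{2}(subnKC kv) exprD mulrA -exprMn.
  have -> : 6 / 5 * (5 / 6) = 1 :> R by field.
  by rewrite expr1n mul1r.
exists F, (A + 10 * A); split=> //; first by move: A0; lra.
move=> m x z Lx z1.
have h1 := @cauchy_sum_step R p m (address x (k + m)) (sigma x (k + m)) z 1
  (size_address _ _) z1 (modulus1 R).
rewrite -address_rcons -/k -/A in h1.
have h2 := hF x (k + m).+1 Lx (leq_trans (leq_addr m k) (leqnSn _)).
rewrite size_address subSn ?leq_addr // addKn in h2.
have e : 2 * (D / (1 - 5 / 6) * (5 / 6) ^+ (k + m).+1) = 10 * A * (5 / 6) ^+ m.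
  rewrite exprS exprD /D.
  have -> : (6 / 5 : R) ^+ k = (5 / 6) ^- k by rewrite -exprVn; congr (_ ^+ _); field.
  by field; rewrite expf_neq0 // mulf_neq0.
rewrite e modulusB in h2.
have := modulus_dist (cauchy_sum p m (circle_point (address x (k + m)) z))
  (cauchy_sum p m.+1 (circle_point (address x (k + m).+1) 1)) (F x).
by move: h1 h2; lra.
Qed.

End coded.

(** * Inverses and signs in uniformly closed algebras *)

Section closed_algebra.
Variables (R : realType) (X : Type) (S : set X).
Local Notation C := (Cplx R).

(** Only values on [S] count, but the functions live on the whole space: this avoids
    going through a function space on [S]. *)
Record closed_algebra_on (D : set (X -> C)) : Prop := {
  closed_algebra_cst : forall c, D (fun=> c);
  closed_algebraD : forall f g, D f -> D g -> D (fun x => f x + g x);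
  closed_algebraM : forall f g, D f -> D g -> D (fun x => f x * g x);
  closed_algebra_bounded : forall f, D f ->
    exists2 M : R, 0 < M & forall x, S x -> modulus (f x) <= M;
  closed_algebra_limit : forall f,
    (forall e : R, 0 < e -> exists2 g, D g & forall x, S x -> modulus (f x - g x) < e) ->
    D f }.

Variable D : set (X -> C).
Hypothesis algD : closed_algebra_on D.

Lemma closed_algebra_eq f g : (forall x, S x -> f x = g x) -> D f -> D g.
Proof.
move=> fg Df; apply: (closed_algebra_limit algD) => e e0; exists f => // x Sx.
by rewrite fg // subrr modulus0.
Qed.

Lemma closed_algebraZ c f : D f -> D (fun x => c * f x).
Proof. by move=> Df; apply: (closed_algebraM algD) => //; exact: (closed_algebra_cst algD). Qed.

Lemma closed_algebraB f g : D f -> D g -> D (fun x => f x - g x).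
Proof.
move=> Df Dg; apply: (closed_algebra_eq (f := fun x => f x + -1 * g x)).
  by move=> x _; rewrite mulN1r.
by apply: (closed_algebraD algD) => //; exact: closed_algebraZ.
Qed.

Lemma closed_algebra_sum (I : Type) (s : seq I) (f : I -> X -> C) :
  (forall i, D (f i)) -> D (fun x => \sum_(i <- s) f i x).
Proof.
move=> Df; elim: s => [|i s IH].
  by apply: (closed_algebra_eq (f := fun=> 0)) => [x _|];
    [rewrite big_nil|exact: (closed_algebra_cst algD)].
apply: (closed_algebra_eq (f := fun x => f i x + \sum_(i <- s) f i x)).
  by move=> x _; rewrite big_cons.
exact: (closed_algebraD algD).
Qed.

Lemma closed_algebraX f n : D f -> D (fun x => f x ^+ n).
Proof.
move=> Df; elim: n => [|n IH]; first exact: (closed_algebra_cst algD).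
apply: (closed_algebra_eq (f := fun x => f x * f x ^+ n)) => [x _|].
  by rewrite exprS.
exact: (closed_algebraM algD).
Qed.

Lemma closed_algebra_neumann f : D f -> (forall x, S x -> modulus (f x) <= 1 / 2) ->
  D (fun x => (1 - f x)^-1).
Proof.
move=> Df hf; apply: (closed_algebra_limit algD) => e e0.
have e2 : 0 < e / 2 by rewrite divr_gt0.
have [|n hn] := @exp_small R (1 / 2) (e / 2) _ e2; first by apply/andP; split; lra.
exists (fun x => \sum_(i <- index_enum 'I_n) f x ^+ i).
  by apply: (@closed_algebra_sum _ _ (fun (i : 'I_n) x => f x ^+ i)) => i; exact: closed_algebraX.
move=> x Sx; have fx := hf x Sx.
have f1 : f x != 1.
  by apply: contraTneq fx => ->; rewrite modulus1 -ltNge; lra.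
rewrite geometric_remainder // modulus_div modulusX.
have h1 : 1 / 2 <= modulus (1 - f x).
  by have := modulus_lower 1 (f x); rewrite modulus1; lra.
rewrite ltr_pdivrMr; last by move: h1; lra.
have h2 : modulus (f x) ^+ n <= (1 / 2) ^+ n by rewrite lerXn2r ?nnegrE //; lra.
have : e * (1 / 2) <= e * modulus (1 - f x) by rewrite ler_wpM2l // ltW.
by move: hn h2; lra.
Qed.

(** The pole is pushed along the imaginary axis, which the range of [f] avoids, from
    a point so far away that the Neumann series converges down to 0. *)
Lemma closed_algebra_inv f (d : R) : D f -> 0 < d ->
  (forall x, S x -> d <= `|complex.Re (f x)|) -> D (fun x => (f x)^-1).
Proof.
move=> Df d0 hd; have [M M0 hM] := closed_algebra_bounded algD Df.
pose t := d / 2; have t0 : 0 < t by rewrite divr_gt0.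
pose b (j : nat) : C := Complex 0 (t * j%:R).
have Re_b x j : complex.Re (f x - b j) = complex.Re (f x) by rewrite ReB /= subr0.
have b_lower x j : S x -> d <= modulus (f x - b j).
  by move=> Sx; rewrite (le_trans (hd x Sx)) // -(Re_b x j) Re_le_modulus.
have [N hN] : exists N : nat, 2 * M <= t * N%:R.
  have h0 : 0 <= 2 * M / t by rewrite divr_ge0 ?mulr_ge0 // ltW.
  exists (Num.Def.archi_bound (2 * M / t)); rewrite [leRHS]mulrC -ler_pdivrMr //.
  exact/ltW/archi_boundP.
have step j : D (fun x => (f x - b j.+1)^-1) -> D (fun x => (f x - b j)^-1).
  move=> Dj; pose c : C := Complex 0 t.
  have Dh : D (fun x => (- c) * (f x - b j.+1)^-1) by exact: closed_algebraZ.
  have hh x : S x -> modulus (- c * (f x - b j.+1)^-1) <= 1 / 2.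
    move=> Sx; rewrite modulusM modulusN modulusV modulusE /= expr0n add0r sqrtr_sqr.
    have hb := b_lower x j.+1 Sx.
    rewrite gtr0_norm // ler_pdivrMr ?(lt_le_trans d0) //.
    by move: hb; rewrite /t; lra.
  have Dp := closed_algebraM algD Dj (closed_algebra_neumann Dh hh).
  apply: closed_algebra_eq Dp.
  move=> x Sx; have nz j' : f x - b j' != 0.
    by rewrite -modulus_gt0 (lt_le_trans d0) // b_lower.
  have e : f x - b j = f x - b j.+1 + c.
    rewrite /b /c; apply/eqP; rewrite eq_complex; case: (f x) => u v /=.
    by rewrite -natr1; apply/andP; split; apply/eqP; ring.
  have nz1 := nz j.+1; rewrite e.
  move: nz1; move: (f x - b j.+1) => w w0.
  by rewrite -invfM mulrBr mulr1 mulNr mulrN opprK mulrCA mulfV // mulr1.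
have DN : D (fun x => (f x - b N)^-1).
  have bN : modulus (b N) = t * N%:R.
    rewrite modulusE /= expr0n add0r sqrtr_sqr ger0_norm //.
    by rewrite mulr_ge0 ?ler0n // ltW.
  have b0 : b N != 0.
    by rewrite -modulus_gt0 bN (lt_le_trans _ hN) // mulr_gt0.
  have hb x : S x -> modulus ((b N)^-1 * f x) <= 1 / 2.
    move=> Sx; rewrite modulusM modulusV mulrC ler_pdivrMr ?modulus_gt0 //.
    by rewrite bN; have := hM x Sx; move: hN; lra.
  have Df' := closed_algebraZ (- (b N)^-1)
    (closed_algebra_neumann (closed_algebraZ (b N)^-1 Df) hb).
  apply: closed_algebra_eq Df' => x Sx.
  have nz : f x - b N != 0 by rewrite -modulus_gt0 (lt_le_trans d0) // b_lower.
  have nz' : b N - f x != 0 by rewrite -opprB oppr_eq0.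
  by field; rewrite nz nz' b0.
have all j : (j <= N)%N -> D (fun x => (f x - b (N - j)%N)^-1).
  elim: j => [_|j IH jN]; first by rewrite subn0.
  apply: step; rewrite -subSn // subSS; exact/IH/ltnW.
have := all N (leqnn N); rewrite subnn; apply: closed_algebra_eq => x _.
by congr (_^-1); rewrite /b mulr0 -[RHS]subr0.
Qed.

Definition Re_sign (z : C) : C := if 0 < complex.Re z then 1 else - 1.

Lemma Re_sign_sqr z : Re_sign z ^+ 2 = 1.
Proof. by rewrite /Re_sign; case: ifP; rewrite ?sqrrN expr1n. Qed.

Definition newton (z : C) : C := (z + z^-1) / 2.

Lemma newton_dist (z e : C) : z != 0 -> e ^+ 2 = 1 ->
  modulus (newton z - e) = modulus (z - e) ^+ 2 / (2 * modulus z).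
Proof.
move=> z0 e1; have -> : newton z - e = (z - e) ^+ 2 / (2 * z).
  have -> : (z - e) ^+ 2 = z ^+ 2 + e ^+ 2 - 2 * z * e by ring.
  by rewrite e1 /newton; field.
rewrite modulus_div modulusX modulusM.
by have -> : modulus (2 : C) = 2 by rewrite -(rmorph_nat (real_complex R)) modulus_real normr_nat.
Qed.

Lemma Re_newton (z : C) : z != 0 ->
  complex.Re (newton z) = complex.Re z * ((1 + modulus z ^- 2) / 2).
Proof.
move=> z0; have -> : newton z = ((2^-1%:C)%C : C) * (z + z^-1).
  by rewrite /newton fmorphV rmorph_nat mulrC.
by rewrite Re_realM ReD Re_inv; ring.
Qed.

Lemma Re_neq0_neq0 (z : C) : complex.Re z != 0 -> z != 0.
Proof. by apply: contraNneq => ->. Qed.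

(** Newton's iteration for the square roots of 1 squares [(z - e) / (z + e)],
    which lies in the unit disc when [e] is the sign of the real part of [z]. *)
Lemma closed_algebra_sign f (d : R) : D f -> 0 < d ->
  (forall x, S x -> d <= `|complex.Re (f x)|) -> D (fun x => Re_sign (f x)).
Proof.
move=> Df d0 hd; have [M M0 hM] := closed_algebra_bounded algD Df.
pose fk k x := iter k newton (f x).
have fkP k : [/\ D (fk k), forall x, S x -> Re_sign (fk k x) = Re_sign (f x) &
    forall x, S x -> d / 2 ^+ k <= `|complex.Re (fk k x)| ].
  elim: k => [|k [Dk sk hk]]; first by split=> // x Sx; rewrite expr0 divr1 hd.
  have dk : 0 < d / 2 ^+ k by rewrite divr_gt0 // exprn_gt0.
  have nz x : S x -> fk k x != 0.
    by move=> Sx; apply: Re_neq0_neq0; rewrite -normr_gt0 (lt_le_trans dk) ?hk.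
  have fac x : 1 / 2 <= (1 + modulus (fk k x) ^- 2) / 2 :> R.
    by rewrite ler_pM2r ?invr_gt0 // lerDl invr_ge0 exprn_ge0.
  split.
  - have := closed_algebraZ 2^-1 (closed_algebraD algD Dk (closed_algebra_inv Dk dk hk)).
    by apply: closed_algebra_eq => x _; rewrite /fk iterS /newton mulrC.
  - move=> x Sx; rewrite -(sk x Sx) /Re_sign /fk iterS -/(fk k x) Re_newton ?nz //.
    by rewrite pmulr_lgt0 // (lt_le_trans _ (fac x)).
  - move=> x Sx; rewrite /fk iterS -/(fk k x) Re_newton ?nz // normrM.
    have f0 : 0 <= (1 + modulus (fk k x) ^- 2) / 2 by apply: le_trans (fac x).
    rewrite (ger0_norm f0).
    rewrite exprSr invfM mulrA; apply: ler_pM; rewrite ?hk ?(ltW dk) //.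
    by have := fac x; rewrite div1r.
(* [q] bounds the square of |(f - e) / (f + e)|: the squared moduli of the two terms
   differ by 4 |Re f|. *)
pose q := 1 - 4 * d / (M + 1) ^+ 2.
have M1 : 0 < (M + 1) ^+ 2 by rewrite exprn_gt0 // addr_gt0.
have start x (e := Re_sign (f x)) : S x ->
    [/\ 0 <= q, q < 1 & modulus (f x - e) ^+ 2 <= q * modulus (f x + e) ^+ 2].
  move=> Sx; have fM := hM x Sx; have hdx := hd x Sx.
  have [ee Ree] : (complex.Im e = 0) /\ (complex.Re e = 1 \/ complex.Re e = - 1).
    by rewrite /e /Re_sign; case: ifP => _ /=; rewrite ?oppr0; split=> //; [left|right].
  have fe : complex.Re (f x) * complex.Re e = `|complex.Re (f x)|.
    rewrite /e /Re_sign; case: ltP => h /=; first by rewrite mulr1 gtr0_norm.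
    by rewrite mulrN1 ler0_norm.
  have Re2 : complex.Re e ^+ 2 = 1 by case: Ree => ->; rewrite ?sqrrN expr1n.
  have up : modulus (f x + e) <= M + 1.
    apply: (le_trans (modulus_triangle _ _)); rewrite lerD //.
    by rewrite /e /Re_sign; case: ifP => _; rewrite ?modulusN modulus1.
  have sqM : modulus (f x + e) ^+ 2 <= (M + 1) ^+ 2.
    by rewrite lerXn2r ?nnegrE // addr_ge0 // ltW.
  have dif : modulus (f x - e) ^+ 2 = modulus (f x + e) ^+ 2 - 4 * `|complex.Re (f x)|.
    rewrite !sqr_modulus ReB ImB ReD ImD ee -fe; ring.
  have h4 : 4 * d <= (M + 1) ^+ 2.
    have : 0 <= modulus (f x - e) ^+ 2 by rewrite exprn_ge0.
    by rewrite dif; move: hdx sqM; lra.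
  split.
  - by rewrite /q subr_ge0 ler_pdivrMr // mul1r.
  - by rewrite /q ltrBlDr ltrDl divr_gt0 // mulr_gt0.
  rewrite dif /q mulrBl mul1r lerD2l lerN2 mulrAC ler_pdivrMr //.
  by apply: ler_pM; rewrite ?mulr_ge0 ?exprn_ge0 ?(ltW d0) // ler_wpM2l.
have conv k x (e := Re_sign (f x)) : S x ->
    modulus (fk k x - e) ^+ 2 <= q ^+ k.+1 * modulus (fk k x + e) ^+ 2.
  move=> Sx; have [q0 q1 h0] := start x Sx.
  elim: k => [|k IH]; first by rewrite expr1.
  have [Dk _ hk] := fkP k.
  have dk : 0 < d / 2 ^+ k by rewrite divr_gt0 // exprn_gt0.
  have nz : fk k x != 0 by apply: Re_neq0_neq0; rewrite -normr_gt0 (lt_le_trans dk) ?hk.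
  have e1 : e ^+ 2 = 1 by exact: Re_sign_sqr.
  rewrite /fk iterS -/(fk k x) newton_dist // -[in X in _ <= _ * X](opprK e).
  rewrite newton_dist ?sqrrN // opprK.
  move: IH; set a := modulus (_ - e); set b := modulus (_ + e).
  have a0 : 0 <= a by exact: modulus_ge0.
  have b0 : 0 <= b by exact: modulus_ge0.
  set w := (2 * modulus _)^-1 => IH.
  have w0 : 0 <= w by rewrite invr_ge0 mulr_ge0.
  have -> : q ^+ k.+2 * (b ^+ 2 * w) ^+ 2 = q ^+ k.+2 * (b ^+ 2) ^+ 2 * w ^+ 2 by ring.
  rewrite [leLHS]exprMn ler_wpM2r ?exprn_ge0 //.
  have : (a ^+ 2) ^+ 2 <= (q ^+ k.+1 * b ^+ 2) ^+ 2.
    by rewrite lerXn2r ?nnegrE ?mulr_ge0 ?exprn_ge0.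
  move/le_trans; apply; rewrite exprMn ler_wpM2r ?exprn_ge0 //.
  rewrite -exprM; apply: ler_wiXn2l => //; first exact: ltW.
  by rewrite muln2 -addnn addSn ltnS leq_addl.
have [[x0 Sx0]|S0] := pselect (exists x, S x); last first.
  by apply: (closed_algebra_eq (f := f)) => // x Sx; case: S0; exists x.
have [q0 q1 _] := start x0 Sx0.
apply: (closed_algebra_limit algD) => e e0.
pose c := Num.min (1 / 2) (e / 5).
have c0 : 0 < c by rewrite lt_min divr_gt0 //= divr_gt0.
have c1 : c <= 1 / 2 by rewrite ge_min lexx.
have c2 : c <= e / 5 by rewrite ge_min lexx orbT.
have [||k hk] := @exp_small R q (c ^+ 2).
- by rewrite q0.
- by rewrite exprn_gt0.
have [Dk _ _] := fkP k; exists (fk k) => // x Sx.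
have h := conv k x Sx; rewrite modulusB.
set g := Re_sign (f x) in h *.
have g1 : modulus g = 1 by rewrite /g /Re_sign; case: ifP => _; rewrite ?modulusN modulus1.
have h' : modulus (fk k x - g) <= c * modulus (fk k x + g).
  rewrite -(@ler_pXn2r _ 2) ?nnegrE ?mulr_ge0 ?(ltW c0) // exprMn (le_trans h) //.
  rewrite ler_wpM2r ?exprn_ge0 // (le_trans _ (ltW hk)) // exprS.
  by rewrite ler_piMl ?exprn_ge0 // ltW.
have h3 : modulus (fk k x + g) <= modulus (fk k x - g) + 2.
  have -> : fk k x + g = (fk k x - g) + (g + g) by ring.
  apply: (le_trans (modulus_triangle3 _ _ _)); rewrite g1; lra.
have h4 : c * modulus (fk k x + g) <= c * (modulus (fk k x - g) + 2).
  by rewrite ler_wpM2l // ltW.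
have h5 : c * modulus (fk k x - g) <= 1 / 2 * modulus (fk k x - g).
  by rewrite ler_wpM2r.
by move: h' h4 h5 c2 e0; lra.
Qed.

End closed_algebra.

(** * The algebra of the Cantor set *)

Section cantor_algebra.
Variables (R : realType) (J : topologicalType).
Hypotheses (compactJ : compact [set: J]) (hausdorffJ : hausdorff_space J).
Variables (L : set J) (sigma : J -> nat -> bool).
Hypothesis coded : coding L sigma.
Local Notation C := (Cplx R).
Local Notation ratio := (ratio R).
Local Notation center := (center R).
Local Notation address := (address sigma).
Local Notation approximable := (@approximable R J L sigma).

Variable planar : J -> C.
Hypothesis continuous_planar : continuous planar.
Hypothesis planar_dist : forall x n, L x ->
  modulus (planar x - center (address x n)) <= 5 * ratio ^+ n.

(** The functions that on [L] come from continuous functions on the Riemann sphere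
    holomorphic off the planar Cantor set; outside [L] they are arbitrary. *)
Definition cantor_algebra : set (J -> C) :=
  [set F | continuous F /\ exists c, approximable F c].

Lemma ratio_small (K e : R) : 0 < K -> 0 < e -> exists n, K * ratio ^+ n < e.
Proof.
move=> K0 e0; have [||n hn] := @exp_small R ratio (e / K).
- by rewrite ltW ?ratio_gt0 // ratio_lt1.
- by rewrite divr_gt0.
by exists n; rewrite mulrC -ltr_pdivlMr.
Qed.

Lemma planar_inj x y : L x -> L y -> planar x = planar y -> x = y.
Proof.
move=> Lx Ly xy; apply: (coding_inj coded) => // k; apply/eqP; apply: contraT => hk.
have dk := ratioX_gt0 R k.
have [//||n hn] := @ratio_small 10 (7 / 16 * ratio ^+ k); first by rewrite mulr_gt0.
pose m := (n + k.+1)%N; have km : (k < m)%N by rewrite /m addnS ltnS leq_addl.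
have hm : ratio ^+ m <= ratio ^+ n by rewrite ratioX_le // leq_addr.
have nE u : nth false (address u m) k = sigma u k by rewrite nth_mkseq.
have ne : address x m != address y m.
  by apply: contraNneq hk => h; rewrite -!nE h.
have ag : (agreement (address x m) (address y m) <= k)%N.
  by apply: agreement_nth; rewrite ?size_address // !nE.
have h1 := center_gap R (etrans (size_address _ _ _) (esym (size_address _ _ _))) ne.
have h2 := ratioX_le R ag.
have h3 := planar_dist m Lx; have h4 := planar_dist m Ly.
have := modulus_dist (center (address x m)) (planar x) (center (address y m)).
rewrite {2}xy (modulusB _ (planar x)).
move=> h5; suff : (0 : R) < 0 by rewrite ltxx.
by move: h1 h2 h3 h4 h5 hn hm dk; lra.
Qed.

Lemma planar_bounded x : L x -> modulus (planar x) <= 7.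
Proof.
move=> Lx; have := planar_dist 0 Lx; rewrite expr0 mulr1 subr0; lra.
Qed.

(** The point coded by the digits of [x] from the [k]-th on; its real part shows
    the first of them. *)
Definition tail_point k x : C := (planar x - center (address x k)) / beta R ^+ k.

Lemma beta_neq0 : beta R != 0.
Proof. by rewrite -modulus_gt0 modulus_beta ratio_gt0. Qed.

Lemma tail_point_dist k x n : L x ->
  modulus (tail_point k x - center (mkseq (fun i => sigma x (k + i)%N) n)) <= 5 * ratio ^+ n.
Proof.
move=> Lx; have bk : beta R ^+ k != 0 by rewrite expf_neq0 // beta_neq0.
have h := planar_dist (k + n) Lx.
have e : address x (k + n) = address x k ++ mkseq (fun i => sigma x (k + i)%N) n.
  rewrite !addressE /mkseq iotaD map_cat add0n; congr (_ ++ _).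
  by rewrite -{1}[k]addn0 iotaDl -map_comp.
move: h; rewrite e center_cat size_address.
set c := center (mkseq _ _).
have -> : planar x - (center (address x k) + beta R ^+ k * c) =
    beta R ^+ k * (tail_point k x - c).
  by rewrite mulrBr /tail_point mulrCA mulfV // mulr1 opprD addrA.
rewrite modulusM modulusX modulus_beta exprD mulrCA ler_pM2l //.
exact: ratioX_gt0.
Qed.

Lemma small_le (a b : R) : (forall n, a <= b + 5 * ratio ^+ n.+1) -> a <= b.
Proof.
move=> h; rewrite leNgt; apply/negP => ba.
have [||n hn] := @ratio_small 5 (a - b); [by []|by rewrite subr_gt0|].
have := ratioX_le R (leqnSn n); have := h n; move: hn; lra.
Qed.

Lemma Re_tail_point k x : L x ->
  if sigma x k then 319 / 544 <= complex.Re (tail_point k x)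
  else complex.Re (tail_point k x) <= 81 / 544.
Proof.
move=> Lx; pose w n := mkseq (fun i => sigma x (k + i)%N) n.
have wE n : w n.+1 = sigma x k :: [seq sigma x (k + i)%N | i <- iota 1 n].
  by rewrite /w /mkseq /= addn0.
have hd n : `|complex.Re (tail_point k x) - complex.Re (center (w n.+1))| <= 5 * ratio ^+ n.+1.
  by rewrite -ReB; apply: (le_trans (Re_le_modulus _)); exact: tail_point_dist.
case E : (sigma x k); apply: small_le => n; have := hd n; rewrite ler_norml => /andP[];
  have := Re_center_cons R (sigma x k) [seq sigma x (k + i)%N | i <- iota 1 n];
  by rewrite -wE E; lra.
Qed.

Lemma planar_tail x : tail_point 0 x = planar x.
Proof. by rewrite /tail_point expr0 divr1 subr0. Qed.

Lemma Re_planar_far (a : bool) x : L x -> sigma x 0%N != a ->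
  7 / 16 <= `|complex.Re (a%:R - planar x)|.
Proof.
move=> Lx xa; have := Re_tail_point 0 Lx; rewrite planar_tail ReB ler_normr.
by case: (sigma x 0%N) a xa => [] [] // _ h; apply/orP; [right|left]; move: h => /=; lra.
Qed.

(** A Cauchy transform vanishes at infinity, and its product with [z] is there minus the
    mass of the measure. *)
Lemma cauchy_transform p : exists F : J -> C, exists K : R,
  [/\ continuous F, approximable F 0,
      approximable (fun x => planar x * F x) (- 1), 0 <= K &
    forall m x z, L x -> modulus z = 1 ->
     modulus (cauchy_sum p m (circle_point (address x (size p + m)) z) - F x)
       <= K * (5 / 6) ^+ m].
Proof.
have [F [K [cF K0 hF]]] := exists_cauchy_transform R compactJ hausdorffJ coded p.
have small e : 0 < e -> exists N, forall m, (N <= m)%N -> K * (5 / 6) ^+ m < e.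
  move=> e0; have K1 : 0 < K + 1 by rewrite ltr_wpDl.
  have [||N hN] := @exp_small R (5 / 6) (e / (K + 1)).
  - by apply/andP; split; lra.
  - by rewrite divr_gt0.
  exists N => m Nm; have : (5 / 6 : R) ^+ m <= (5 / 6) ^+ N by apply: ler_wiXn2l => //; lra.
  move: hN; rewrite ltr_pdivlMr //.
  have : 0 <= (5 / 6 : R) ^+ N by rewrite exprn_ge0 //; lra.
  set u := _ ^+ m; set v := _ ^+ N => v0 h1 uv.
  have : K * u <= K * v by rewrite ler_wpM2l.
  by move: h1 K0 v0; lra.
exists F, K; split=> //.
- move=> e /small[N hN]; exists (size p + N)%N => n Nn.
  have nE : n = (size p + (n - size p))%N by rewrite subnKC // (leq_trans _ Nn) // leq_addr.
  exists (cauchy_sum p (n - size p)); first by rewrite {1}nE; exact: cell_rational_cauchy.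
  move=> x z Lx z1; apply: le_lt_trans (hN (n - size p)%N _).
    by rewrite {2}nE; exact: hF.
  by rewrite leq_subRL // (leq_trans _ Nn) // leq_addr.
- have [M M0 hM] := modulus_bounded compactJ (closed_coded coded) cF.
  move=> e e0; have d0 : 0 < Num.min 1 (e / 16) by rewrite lt_min ltr01 divr_gt0.
  have [N hN] := small _ d0.
  have [|n0 hn0] := @ratio_small (6 * (M + 1)) (e / 2) _ (divr_gt0 e0 (ltr0Sn _ 1)).
    by move: M0; lra.
  exists (size p + N + n0)%N => n Nn.
  have pn : (size p <= n)%N by rewrite (leq_trans _ Nn) // -addnA leq_addr.
  have nE : n = (size p + (n - size p))%N by rewrite subnKC.
  exists (fun z => z * cauchy_sum p (n - size p) z).
    by rewrite {1}nE; exact: cell_rational_cauchy_shift.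
  move=> x z Lx z1.
  have h1 : modulus (cauchy_sum p (n - size p) (circle_point (address x n) z) - F x) <
      Num.min 1 (e / 16).
    apply: le_lt_trans (hN (n - size p)%N _); first by rewrite {2}nE; exact: hF.
    by rewrite leq_subRL // (leq_trans _ Nn) // leq_addr.
  move: h1; rewrite lt_min => /andP[h1 h2].
  have h3 : modulus (circle_point (address x n) z - planar x) <= 6 * ratio ^+ n.
    have := modulus_dist (circle_point (address x n) z) (center (address x n)) (planar x).
    rewrite (circle_point_dist _ z1) size_address (modulusB (center _)) /radius.
    by have := planar_dist n Lx; have := ratioX_gt0 R n; set r := ratio ^+ n; lra.
  have h4 : ratio ^+ n <= ratio ^+ n0 by rewrite ratioX_le // (leq_trans _ Nn) // leq_addl.
  move: h1 h2 h3; set c := circle_point _ _; set S := cauchy_sum _ _ _ => h1 h2 h3.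
  have -> : c * S - planar x * F x = (c - planar x) * S + planar x * (S - F x) by ring.
  apply: (le_lt_trans (modulus_triangle _ _)); rewrite !modulusM.
  have h5 : modulus S <= M + 1.
    by have := modulus_lower S (F x); have := hM x Lx; move: h1; lra.
  have h6 : modulus (c - planar x) * modulus S <= 6 * ratio ^+ n0 * (M + 1).
    by apply: ler_pM => //; move: h3 h4; lra.
  have h7 : modulus (planar x) * modulus (S - F x) <= 7 * (e / 16).
    by apply: ler_pM => //; [exact: planar_bounded|exact: ltW].
  by move: h6 h7 hn0 e0; lra.
Qed.

(** Near a point of one half of the Cantor set, the algebra holds approximate
    simple poles for the other half. *)
Lemma cauchy_transform_pole (a : bool) (e : R) : 0 < e -> exists F : J -> C,
  [/\ continuous F, approximable F 0, approximable (fun x => planar x * F x) (- 1) &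
    forall x, L x -> sigma x 0%N != a -> modulus (F x - (a%:R - planar x)^-1) < e].
Proof.
move=> e0; have e2 : 0 < e / 2 by rewrite divr_gt0.
have [//|k hk] := @ratio_small 80 (e / 2) _ e2.
have [F [K [cF aF apF K0 hF]]] := cauchy_transform (a :: nseq k false).
exists F; split=> // x Lx xa.
have K1 : 0 < K + 1 by rewrite ltr_wpDl.
have [||m hm] := @exp_small R (5 / 6) (e / 2 / (K + 1)).
- by apply/andP; split; lra.
- by rewrite divr_gt0.
have h1 := hF m x 1 Lx (modulus1 R).
have sp : size (a :: nseq k false) = k.+1 by rewrite /= size_nseq.
rewrite sp in h1.
have h2 := @cauchy_sum_far R a k m (address x (k.+1 + m)) 1 (planar x) (size_address _ _ _).
have {}h2 := h2 _ (modulus1 R) _ (le_trans (Re_planar_far Lx xa) (Re_le_modulus _)).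
have h3 : agreement (a :: nseq k false) (address x (k.+1 + m)) = 0%N.
  by rewrite addressE /mkseq /= eq_sym (negbTE xa).
have h4 : modulus (planar x - center (address x (k.+1 + m))) <=
    5 * ratio ^+ size (address x (k.+1 + m)) by rewrite size_address; exact: planar_dist.
move: {h2}(h2 h3 h4) h1; set S := cauchy_sum _ _ _ => h2 h1.
have := modulus_dist (F x) S (a%:R - planar x)^-1; rewrite (modulusB _ S).
have h5 := ratioX_le R (leqnSn k).
have : K * (5 / 6) ^+ m < e / 2.
  move: hm; rewrite ltr_pdivlMr // mulrDr mulr1 mulrC; apply: le_lt_trans.
  by rewrite lerDl exprn_ge0 //; lra.
by move: h1 h2 h5 hk; lra.
Qed.

Section half.
Variable i : bool.

Let S : set J := L `&` [set x | sigma x 0%N = i].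

(** The closure, for uniform convergence on one half of [L], of the algebra. The goal of
    this section is that it contains all continuous functions. *)
Definition half_closure : set (J -> C) :=
  [set g | forall e : R, 0 < e -> exists2 F, cantor_algebra F &
    forall x, S x -> modulus (F x - g x) < e].

Lemma cantor_algebraD F G : cantor_algebra F -> cantor_algebra G ->
  cantor_algebra (fun x => F x + G x).
Proof.
move=> [cF [c aF]] [cG [d aG]]; split; first exact: continuousDc.
by exists (c + d); exact: approximableD.
Qed.

Lemma cantor_algebraM F G : cantor_algebra F -> cantor_algebra G ->
  cantor_algebra (fun x => F x * G x).
Proof.
move=> [cF [c aF]] [cG [d aG]]; split; first exact: continuousMc.
by exists (c * d); exact: approximableM.
Qed.

Lemma cantor_algebra_cst c : cantor_algebra (fun=> c).
Proof. by split; [exact: continuous_cstc|exists c; exact: approximable_cst]. Qed.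

Lemma half_closure_algebra : closed_algebra_on S half_closure.
Proof.
have bd g : half_closure g -> exists2 M : R, 0 < M & forall x, S x -> modulus (g x) <= M.
  move=> /(_ 1 ltr01)[F [cF _] hF].
  have [M M0 hM] := modulus_bounded compactJ (closed_coded coded) cF.
  exists (M + 1); first by rewrite addr_gt0.
  move=> x Sx; have := hF x Sx; have := hM x Sx.1.
  by have := modulus_lower (g x) (F x); rewrite modulusB; lra.
split=> //.
- move=> c e e0; exists (fun=> c); first exact: cantor_algebra_cst.
  by move=> x _; rewrite subrr modulus0.
- move=> f g hf hg e e0; have e2 : 0 < e / 2 by rewrite divr_gt0.
  have [F AF hF] := hf _ e2; have [G AG hG] := hg _ e2.
  exists (fun x => F x + G x); first exact: cantor_algebraD.
  move=> x Sx; have := hF x Sx; have := hG x Sx.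
  have -> : F x + G x - (f x + g x) = (F x - f x) + (G x - g x) by ring.
  by have := modulus_triangle (F x - f x) (G x - g x); lra.
- move=> f g hf hg e e0.
  have [M M0 hM] := bd f hf; have [M' M0' hM'] := bd g hg.
  have [d d0 hd] := modulus_mul_close (ltW M0) (ltW M0') e0.
  have [F AF hF] := hf _ d0; have [G AG hG] := hg _ d0.
  exists (fun x => F x * G x); first exact: cantor_algebraM.
  by move=> x Sx; apply: hd; rewrite ?hM ?hM' ?hF ?hG.
- move=> f hf e e0; have e2 : 0 < e / 2 by rewrite divr_gt0.
  have [g hg gf] := hf _ e2; have [F AF hF] := hg _ e2.
  exists F => // x Sx; have := gf x Sx; have := hF x Sx; rewrite (modulusB (f x)).
  by have := modulus_dist (F x) (g x) (f x); lra.
Qed.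

Let D := half_closure.
Let algD := half_closure_algebra.

(** A point [a] of the other half gives the pole [1 / (a - planar)], whose real part has
    constant sign on this half, so that it can be inverted. *)
Lemma half_closure_planar : D planar.
Proof.
pose a := ~~ i; have Sa x : S x -> sigma x 0%N != a.
  by move=> [_ /= ->]; rewrite /a; case: (i).
have Dpole : D (fun x => (a%:R - planar x)^-1).
  move=> e /(cauchy_transform_pole a)[F [cF aF _ hF]]; exists F; first by split=> //; exists 0.
  by move=> x Sx; apply: hF (Sa x Sx); case: Sx.
pose d : R := 7 / 16 / 8 ^+ 2.
have d0 : 0 < d by rewrite !divr_gt0 // exprn_gt0.
have hd x : S x -> d <= `|complex.Re (a%:R - planar x)^-1|.
  move=> Sx; have h := Re_planar_far Sx.1 (Sa x Sx).
  have h8 : modulus (a%:R - planar x) <= 8.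
    have := planar_bounded Sx.1; have := modulus_bool R a.
    by have := modulus_triangleB (a%:R : C) (planar x); lra.
  have h0 : 0 < modulus (a%:R - planar x).
    by apply: lt_le_trans (Re_le_modulus _); apply: lt_le_trans h; lra.
  rewrite Re_inv normrM [X in _ <= _ * X]ger0_norm ?invr_ge0 ?exprn_ge0 //.
  apply: ler_pM => //; rewrite ?invr_ge0 ?exprn_ge0 // ?lef_pV2 ?posrE ?exprn_gt0 //.
  by rewrite lerXn2r ?nnegrE.
have Dinv := closed_algebra_inv algD Dpole d0 hd.
have := closed_algebraB algD (closed_algebra_cst algD a%:R) Dinv.
by apply: closed_algebra_eq algD _ _ _ => x _; rewrite invrK opprB addrC subrK.
Qed.

(** The real part of a tail point is off 25 / 68, the middle of the gap between the
    two cases of [Re_tail_point], and the side on which it lies is the digit. *)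
Lemma half_closure_digit_step n : D (fun x => center (address x n)) ->
  D (fun x => (sigma x n)%:R).
Proof.
move=> Dn; have Dt : D (fun x => tail_point n x - 25 / 68).
  apply: (closed_algebra_eq algD (f := fun x =>
    (beta R ^+ n)^-1 * (planar x - center (address x n)) - 25 / 68)).
    by move=> x _; rewrite mulrC.
  apply: (closed_algebraB algD); last exact: (closed_algebra_cst algD).
  apply: (closed_algebraZ algD); apply: (closed_algebraB algD) => //.
  exact: half_closure_planar.
have ReE x : complex.Re (tail_point n x - 25 / 68) = complex.Re (tail_point n x) - 25 / 68.
  rewrite ReB; congr (_ - _).
  have -> : (25 / 68 : C) = ((25 / 68 : R)%:C)%C by rewrite fmorph_div !rmorph_nat.
  by [].
have hd x : S x -> 7 / 32 <= `|complex.Re (tail_point n x - 25 / 68)|.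
  move=> [Lx _]; rewrite ReE ler_normr; have := Re_tail_point n Lx.
  by case: ifP => _ h; apply/orP; [left|right]; move: h; lra.
have h32 : 0 < 7 / 32 :> R by lra.
have Ds := closed_algebra_sign algD Dt h32 hd.
have := closed_algebraZ algD 2^-1 (closed_algebraD algD Ds (closed_algebra_cst algD 1)).
apply: (closed_algebra_eq algD) => x [Lx _]; rewrite /Re_sign ReE.
have := Re_tail_point n Lx; case: (sigma x n) => h.
  have -> : 0 < complex.Re (tail_point n x) - 25 / 68 by move: h; lra.
  by rewrite mulr1n; field.
have -> : (0 < complex.Re (tail_point n x) - 25 / 68) = false.
  by apply/negbTE; rewrite -leNgt; move: h; lra.
by rewrite addNr mulr0.
Qed.

Lemma half_closure_center k : D (fun x => center (address x k)).
Proof.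
elim: k => [|k IH]; first exact: (closed_algebra_cst algD).
apply: (closed_algebra_eq algD (f := fun x =>
  center (address x k) + beta R ^+ k * (sigma x k)%:R)).
  by move=> x _; rewrite address_rcons center_rcons size_address.
apply: (closed_algebraD algD) => //; apply: (closed_algebraZ algD).
exact: half_closure_digit_step.
Qed.

Lemma half_closure_cell v : D (fun x => (address x (size v) == v)%:R).
Proof.
elim/last_ind: v => [|v a IH]; first exact: (closed_algebra_cst algD).
have Dn := half_closure_digit_step (half_closure_center (size v)).
have Da : D (fun x => (sigma x (size v) == a)%:R).
  case: a; first by apply: (closed_algebra_eq algD) Dn => x _; rewrite eqb_id.
  have := closed_algebraB algD (closed_algebra_cst algD 1) Dn.
  apply: (closed_algebra_eq algD) => x _.
  by case: (sigma x (size v)); rewrite /= ?subrr ?subr0.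
have := closed_algebraM algD IH Da; apply: (closed_algebra_eq algD) => x _.
by rewrite size_rcons address_rcons eqseq_rcons -natrM mulnb.
Qed.

(** Cells shrink, so continuous functions are uniform limits of step functions. *)
Lemma half_closure_continuous (F : J -> C) : continuous F -> D F.
Proof.
move=> cF; apply: (closed_algebra_limit algD) => e e0.
have [N hN] := uniform_on_cells compactJ coded cF e0.
have /choice[xv hxv] : forall v, exists x, L x /\ address x (size v) = v.
  by move=> v; have [x Lx hx] := coding_onto coded v; exists x.
exists (fun x => \sum_(t <- enum {: N.-tuple bool})
   F (xv (tval t)) * (address x (size (tval t)) == tval t)%:R).
  apply: (@closed_algebra_sum _ _ _ _ algD _ _
    (fun (t : N.-tuple bool) x => F (xv (tval t)) * (address x (size (tval t)) == tval t)%:R)).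
  by move=> t; apply: (closed_algebraZ algD); exact: half_closure_cell.
move=> x [Lx _]; pose t := Tuple (introT eqP (size_address sigma x N)).
rewrite (bigD1_seq t) ?mem_enum ?enum_uniq //= size_address eqxx mulr1 big1 ?addr0.
  have [Ly ay] := hxv (address x N); apply: (hN N) => //.
  by rewrite size_address in ay; rewrite ay.
move=> t' /eqP tt'; rewrite size_tuple.
case: eqP => [e'|_]; last by rewrite mulr0.
by case: tt'; apply: val_inj; rewrite /= e'.
Qed.

End half.

End cantor_algebra.

(** * Convexity of the sets with dense restriction *)

Lemma finite_subcover (J : topologicalType) (K : set J) (U : J -> set J) : compact K ->
  (forall x, K x -> nbhs x (U x)) ->
  exists2 s : seq J, uniq s & forall y, K y -> exists2 x, x \in s & U x y.
Proof.
move=> /compact_near_coveringP cK hU.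
(* The filter of the finite sequences that contain any given one. *)
pose F : set_system (seq J) := [set P : set (seq J) |
  exists s0 : seq J, forall s : seq J, {subset s0 <= s} -> P s].
have FF : Filter F.
  split=> [|P Q [s hs] [t ht]|P Q PQ [s hs]].
  - by exists [::].
  - exists (s ++ t) => u hu; split.
      by apply: hs => x xs; apply: hu; rewrite mem_cat xs.
    by apply: ht => x xt; apply: hu; rewrite mem_cat xt orbT.
  - by exists s => u /hs /PQ.
have [|s hs] := cK _ F (fun s y => exists2 x, x \in s & U x y) FF.
  move=> x Kx; exists (U x, [set s : seq J | x \in s]) => /=.
    split; first exact: hU.
    by exists [:: x] => s /(_ x); apply; rewrite mem_head.
  by move=> [y s] /= [Uy xs]; exists x.
exists (undup s); first exact: undup_uniq.
by move=> y Ky; apply: hs => // x; rewrite mem_undup.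
Qed.

Section characters.
Variables (R : realType) (J : topologicalType).
Local Notation C := (Cplx R).
Variable A : set (J -> C).
Hypothesis uaA : is_uniform_algebra A.

Definition element (F : J -> C) (AF : A F) : A := exist _ F (mem_set AF).

Lemma element_prop (f : A) : A (\val f).
Proof. exact: set_mem (valP f). Qed.

Lemma point_eval_character x : max_ideal_space A (point_eval A x).
Proof.
split.
- exists (element (ua_const uaA 1)); rewrite /point_eval /=; exact: oner_neq0.
- by move=> f g h e; rewrite /point_eval e.
- by move=> c f h e; rewrite /point_eval e.
- by move=> f g h e; rewrite /point_eval e.
Qed.

Variable phi : A -> C.
Hypothesis phiP : max_ideal_space A phi.

(** Extending by 0 spares carrying membership proofs along. *)
Definition character_fun (F : J -> C) : C :=
  if pselect (A F) is left AF then phi (element AF) else 0.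

Lemma character_funE (f : A) : character_fun (\val f) = phi f.
Proof.
rewrite /character_fun; case: pselect => [AF|]; last by case; exact: element_prop.
by congr phi; apply: val_inj.
Qed.

Lemma character_fun_element (F : J -> C) (AF : A F) : character_fun F = phi (element AF).
Proof. by rewrite -character_funE. Qed.

Lemma character_funD F G : A F -> A G ->
  character_fun (F + G) = character_fun F + character_fun G.
Proof.
move=> AF AG; have [_ h _ _] := phiP.
rewrite (character_fun_element AF) (character_fun_element AG)
  (character_fun_element (ua_add uaA AF AG)).
exact: h.
Qed.

Lemma character_funM F G : A F -> A G ->
  character_fun (F * G) = character_fun F * character_fun G.
Proof.
move=> AF AG; have [_ _ _ h] := phiP.
rewrite (character_fun_element AF) (character_fun_element AG)
  (character_fun_element (ua_mul uaA AF AG)).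
exact: h.
Qed.

Lemma character_funZ c F : A F -> character_fun (c *: F) = c * character_fun F.
Proof.
move=> AF; have [_ _ h _] := phiP.
rewrite (character_fun_element AF) (character_fun_element (ua_scale uaA c AF)).
exact: h.
Qed.

Lemma character_fun_cst c : character_fun (cst c) = c.
Proof.
have A1 := ua_const uaA 1; have [[f f0] _ _ h] := phiP.
have e : phi f = phi f * phi (element A1).
  by apply: h => /=; rewrite mulr1.
have h1 : character_fun (cst 1) = 1.
  by rewrite (character_fun_element A1); apply: (mulfI f0); rewrite -e mulr1.
have -> : cst c = c *: cst 1 :> (J -> C).
  by apply/funext => x; rewrite scalrfctE /GRing.scale /= mulr1.
by rewrite character_funZ // h1 mulr1.
Qed.

Lemma character_fun_shift F : A F ->
  A (F + cst (- character_fun F)) /\ character_fun (F + cst (- character_fun F)) = 0.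
Proof.
move=> AF; have Ac := ua_const uaA (- character_fun F).
by split; [exact: ua_add|rewrite character_funD // character_fun_cst subrr].
Qed.

End characters.

Section convexity.
Variables (R : realType) (J : topologicalType).
Hypotheses (compactJ : compact [set: J]).
Local Notation C := (Cplx R).
Variable A : set (J -> C).
Hypothesis uaA : is_uniform_algebra A.
Variable K : set J.
Hypothesis closedK : closed K.
Hypothesis dense : forall (g : J -> C) (e : R), continuous g -> 0 < e ->
  exists2 F, A F & forall x, K x -> modulus (F x - g x) < e.

Let compactK : compact K := closed_compactJ compactJ closedK.

Section hull_point.
Variable phi : A -> C.
Hypothesis phi_hull : A_convex_hull (point_eval A @` K) phi.
Local Notation Phi := (character_fun phi).

Lemma hull_bound F (B : R) : A F -> 0 <= B -> (forall x, K x -> modulus (F x) <= B) ->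
  modulus (Phi F) <= B.
Proof.
move=> AF B0 hB; have [_ h] := phi_hull; rewrite (character_fun_element phi AF).
apply: le_trans (h (element AF)) _.
set E := [set _ | _ in _]; have [->|/set0P E0] := eqVneq E set0; first by rewrite sup0.
apply: ge_sup => // _ [_ [x Kx <-] <-]; exact: hB.
Qed.

(** Limits on [K] of the kernel of the character: by density an ideal of the
    algebra of all continuous functions on [K]. *)
Definition kernel_closure (g : J -> C) := forall e : R, 0 < e -> exists F,
  [/\ A F, Phi F = 0 & forall x, K x -> modulus (F x - g x) < e].

Lemma kernel_closure_sum (I : Type) (s : seq I) (g : I -> J -> C) :
  (forall i, kernel_closure (g i)) -> kernel_closure (fun x => \sum_(i <- s) g i x).
Proof.
have phiP := phi_hull.1.
move=> hg; elim: s => [|i s IH] e e0.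
  exists (cst 0); split; [exact: ua_const|exact: character_fun_cst|].
  by move=> x _; rewrite big_nil subrr modulus0.
have e2 : 0 < e / 2 by rewrite divr_gt0.
have [F [AF F0 hF]] := hg i _ e2; have [G [AG G0 hG]] := IH _ e2.
exists (F + G); split; first exact: ua_add.
  by rewrite character_funD // F0 G0 addr0.
move=> x Kx; have := hF x Kx; have := hG x Kx; rewrite big_cons.
set t := \sum_(_ <- _) _; have -> : (F + G) x - (g i x + t) = (F x - g i x) + (G x - t).
  by rewrite addrfctE; ring.
by have := modulus_triangle (F x - g i x) (G x - t); lra.
Qed.

Lemma kernel_closure_conj H : A H -> Phi H = 0 ->
  kernel_closure (fun x => H x * (H x)^*%C).
Proof.
move=> AH H0 e e0; have cH := ua_continuous uaA AH.
have [M M0 hM] := modulus_bounded compactJ closedK cH.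
have [k Ak hk] := dense (continuous_conj cH) (divr_gt0 e0 M0).
exists (H * k); split; first exact: ua_mul.
  by rewrite (character_funM uaA phi_hull.1) // H0 mul0r.
move=> x Kx; have -> : (H * k) x - H x * (H x)^*%C = H x * (k x - (H x)^*%C).
  by rewrite mulrfctE; ring.
rewrite modulusM; have := hk x Kx; rewrite ltr_pdivlMr // mulrC; apply: le_lt_trans.
by rewrite ler_wpM2r // hM.
Qed.

(** Otherwise finitely many functions in the kernel have no common zero on [K]. The sum
    [q] of their squared moduli lies in [kernel_closure] and is bounded below, so for [F]
    in the kernel close to [q] the function [1 - F / N], sent to 1, is smaller
    than 1 on [K]. *)
Lemma hull_point_eval : exists2 x, K x & phi = point_eval A x.
Proof.
have phiP := phi_hull.1; apply: contrapT => h.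
have /choice[H hH] : forall x, exists F, [/\ A F, Phi F = 0 & K x -> F x != 0].
  move=> x; have [Kx|nK] := pselect (K x); last first.
    by exists (cst 0); split=> //; [exact: ua_const|exact: character_fun_cst].
  apply: contrapT => h'; apply: h; exists x => //; apply/funext => f.
  apply: contrapT => fx; apply: h'.
  have [AF F0] := character_fun_shift uaA phiP (element_prop f).
  exists (\val f + cst (- Phi (\val f))); split=> // _.
  by rewrite addrfctE subr_eq0 character_funE; apply/eqP => e; apply: fx.
have nH x : K x -> nbhs x [set y | H x y != 0].
  move=> Kx; have [/(ua_continuous uaA)/cplx_continuousP cH _ /(_ Kx) Hx] := hH x.
  have := cH x (modulus (H x x)); rewrite modulus_gt0 => /(_ Hx).
  by apply: filterS => y; apply: contraTneq => ->; rewrite subr0 ltxx.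
have [D uniqD hD] := finite_subcover compactK nH.
pose q x : C := \sum_(i <- D) H i x * (H i x)^*%C.
have qE x : q x = ((\sum_(i <- D) modulus (H i x) ^+ 2)%:C)%C.
  by rewrite /q rmorph_sum; apply: eq_bigr => i _; rewrite mul_conjc.
have cq : continuous q.
  rewrite /q; elim: {uniqD hD q qE} D => [|i s IH].
    have -> : (fun x => \sum_(i <- [::]) H i x * (H i x)^*%C) = (fun=> 0).
      by apply/funext => x; rewrite big_nil.
    exact: continuous_cstc.
  have -> : (fun x => \sum_(i <- i :: s) H i x * (H i x)^*%C) =
      (fun x => H i x * (H i x)^*%C + \sum_(i <- s) H i x * (H i x)^*%C).
    by apply/funext => x; rewrite big_cons.
  have [/(ua_continuous uaA) cH _ _] := hH i.
  exact/continuousDc/IH/continuousMc/continuous_conj.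
have q0 x : K x -> q x != 0.
  move=> /hD[i iD hi]; rewrite qE -(rmorph0 (real_complex R)).
  rewrite (inj_eq (@complexI R)) gt_eqF // (bigD1_seq i) ?uniqD //=.
  by rewrite ltr_pwDl ?exprn_gt0 ?modulus_gt0 // sumr_ge0 // => j _; rewrite exprn_ge0.
have [d d0 hd] := avoided_value compactK cq q0.
have [M M0 hM] := modulus_bounded compactJ closedK cq.
have d2 : 0 < d / 2 by rewrite divr_gt0.
have [F [AF F0 hF]] : exists F, [/\ A F, Phi F = 0 &
    forall x, K x -> modulus (F x - q x) < d / 2].
  apply: (@kernel_closure_sum _ D (fun i x => H i x * (H i x)^*%C)) d2 => i.
  by have [AHi Hi0 _] := hH i; exact: kernel_closure_conj.
(* With this [N], the values of [1 - q / N] on [K] lie between 0 and 1 - d / N. *)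
pose N := M + d; have N0 : 0 < N by rewrite addr_gt0.
pose c : C := ((- N^-1)%:C)%C.
have AcF := ua_scale uaA c AF; have A1 := ua_const uaA 1.
have /hull_bound hb := ua_add uaA A1 AcF.
have PhiG : Phi (cst 1 + c *: F) = 1.
  by rewrite character_funD // character_fun_cst // character_funZ // F0 mulr0 addr0.
have B1 : d / 2 / N < 1.
  by rewrite ltr_pdivrMr // mul1r /N; move: M0 d0; lra.
have := hb (1 - d / 2 / N); rewrite PhiG modulus1 subr_ge0 => /(_ (ltW B1)).
have B0 : 0 < d / 2 / N by rewrite !divr_gt0.
suff hG x : K x -> modulus ((cst 1 + c *: F) x) <= 1 - d / 2 / N.
  by move=> /(_ hG); move: B0; lra.
move=> Kx; pose r := \sum_(i <- D) modulus (H i x) ^+ 2.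
have r0 : 0 <= r by rewrite sumr_ge0 // => j _; rewrite exprn_ge0.
have qr : q x = (r%:C)%C := qE x.
have mq : modulus (q x) = r by rewrite qr modulus_real ger0_norm.
have hr := hd x Kx; rewrite subr0 mq in hr; have hr' := hM x Kx; rewrite mq in hr'.
have -> : (cst 1 + c *: F) x = (((1 - r / N)%:C)%C : C) + c * (F x - q x).
  have -> : (cst 1 + c *: F) x = 1 + c * F x by [].
  rewrite qr mulrBr /c rmorphB rmorph1 rmorphN rmorphM /=.
  by ring.
apply: (le_trans (modulus_triangle _ _)).
rewrite modulusM !modulus_real normrN [`|N^-1|]gtr0_norm ?invr_gt0 //.
have rN : r / N <= 1 by rewrite ler_pdivrMr // mul1r /N; move: hr' d0; lra.
rewrite ger0_norm ?subr_ge0 //.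
have h1 : d / N <= r / N by rewrite ler_pM2r ?invr_gt0.
have h2 : N^-1 * modulus (F x - q x) <= N^-1 * (d / 2).
  by rewrite ler_wpM2l ?invr_ge0 ?(ltW N0) // ltW // hF.
have e1 : d / N = d / 2 / N + N^-1 * (d / 2) by field; rewrite gt_eqF.
by move: h1 h2 e1; lra.
Qed.

End hull_point.

(** A character bounded by the supremum over [K] extends to all continuous
    functions on [K], hence is the evaluation at a point of [K]. *)
Lemma dense_restriction_A_convex : A_convex (point_eval A @` K).
Proof.
apply/seteqP; split=> [phi /hull_point_eval[x Kx ->]|_ [x Kx <-]].
  by exists x.
split; first exact: point_eval_character.
move=> f; have [M M0 hM] := modulus_bounded compactJ closedK (ua_continuous uaA (element_prop f)).
apply: ub_le_sup; last by exists (point_eval A x) => //; exists x.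
by exists M => _ [_ [y Ky <-] <-]; exact: hM.
Qed.

End convexity.

Section restrictions.
Variables (R : realType) (J : topologicalType).
Hypotheses (compactJ : compact [set: J]) (hausdorffJ : hausdorff_space J).
Local Notation C := (Cplx R).
Variable A : set (J -> C).
Hypothesis uaA : is_uniform_algebra A.
Variable K : set J.
Hypothesis closedK : closed K.
Hypothesis dense : forall (g : J -> C) (e : R), continuous g -> 0 < e ->
  exists2 F, A F & forall x, K x -> modulus (F x - g x) < e.

Lemma dense_restriction_uclosure :
  uclosure (restriction_algebra A K) = continuous_functions R K.
Proof.
apply/seteqP; split=> [f /uclosureP h|f cf].
  apply: continuous_uniform_limit => e /h[_ [F AF <-] hF].
  exists (fun x : K => F (\val x)) => // x.
  apply: (@continuous_comp K J C); first exact: initial_continuous.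
  exact: (ua_continuous uaA AF).
pose f' (x : J) : C := if pselect (K x) is left Kx then f (exist _ x (mem_set Kx)) else 0.
have f'E (x : K) : f' (\val x) = f x.
  rewrite /f'; case: pselect => [Kx|[]]; last exact: set_mem (valP x).
  by congr f; apply: val_inj.
have cf' : {within K, continuous f'}.
  apply/subspace_sigL_continuousP; have -> : sigL K f' = f by apply/funext => x; exact: f'E.
  exact: cf.
have [G cG hG] := tietze_complex compactJ hausdorffJ closedK cf'.
apply/uclosureP => e e0; have [F AF hF] := dense cG e0.
exists (fun x : K => F (\val x)); first by exists F.
move=> x; have Kx : K (\val x) := set_mem (valP x).
by rewrite -f'E -hG // modulusB; exact: hF.
Qed.

End restrictions.

(** * Properties of the algebra *)

Section algebra_properties.
Variables (R : realType) (J : topologicalType).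
Hypotheses (compactJ : compact [set: J]) (hausdorffJ : hausdorff_space J).
Variables (L : set J) (sigma : J -> nat -> bool).
Hypothesis coded : coding L sigma.
Local Notation C := (Cplx R).
Local Notation approximable := (@approximable R J L sigma).
Local Notation A := (@cantor_algebra R J L sigma).

Variable planar : J -> C.
Hypothesis continuous_planar : continuous planar.
Hypothesis planar_dist : forall x n, L x ->
  modulus (planar x - center R (address sigma x n)) <= 5 * ratio R ^+ n.

Lemma cantor_algebra_off_L (F G : J -> C) : A F -> continuous G ->
  (forall x, L x -> G x = F x) -> A G.
Proof.
move=> [cF [c aF]] cG GF; split=> //; exists c.
by apply: approximable_eq aF => x Lx; rewrite GF.
Qed.

Lemma cantor_algebra_planar_shift (F : J -> C) w : continuous F -> approximable F 0 ->
  approximable (fun x => planar x * F x) (- 1) ->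
  continuous (fun x => (planar x - w) * F x) /\
  approximable (fun x => (planar x - w) * F x) (- 1).
Proof.
move=> cF aF apF; split.
  exact: (continuousMc (continuousDc continuous_planar (@continuous_cstc R J (- w))) cF).
have := approximableD apF (approximableZ (- w) aF); rewrite mulr0 addr0.
by apply: approximable_eq => x _; ring.
Qed.

Lemma closed_point (x : J) : closed [set x].
Proof. exact/accessible_closed_set1/hausdorff_accessible. Qed.

Lemma vanishing_on_L (x y : J) : ~ L x -> x != y ->
  exists F : J -> C, [/\ A F, F x = 1 & F y = 0].
Proof.
move=> Lx xy; have cL := closed_coded coded.
have [|u [cu _ u0 u1]] := @urysohn_function R J compactJ hausdorffJ
    (L `|` [set y]) [set x] (closedU cL (@closed_point y)) (@closed_point x).
  by apply/seteqP; split=> // z [[Lz|/= zy] /= zx]; move: xy; rewrite -?zx -?zy ?eqxx // => _;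
    apply: Lx; rewrite -zx.
exists (fun z => ((u z)%:C)%C); split.
- apply: (cantor_algebra_off_L (cantor_algebra_cst L sigma (0 : C))).
    exact: continuous_real_complex.
  by move=> z Lz; rewrite u0 //; left.
- by rewrite u1.
- by rewrite u0 //; right.
Qed.

(** On [L], the factor [planar - planar x] vanishes only at [x]; times a Cauchy transform
    that does not vanish at [y] it is in the algebra. *)
Lemma cantor_algebra_separates x y : x != y -> exists2 F, A F & F x != F y.
Proof.
move=> xy; have [Lx|Lx] := pselect (L x); last first.
  by have [F [AF e1 e2]] := vanishing_on_L Lx xy; exists F; rewrite // e1 e2 oner_neq0.
have [Ly|Ly] := pselect (L y); last first.
  have yx : y != x by rewrite eq_sym.
  by have [F [AF e1 e2]] := vanishing_on_L Ly yx; exists F; rewrite // e1 e2 eq_sym oner_neq0.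
pose a := ~~ sigma y 0%N; have ya : sigma y 0%N != a by rewrite /a; case: (sigma y 0%N).
pose w : C := (a%:R - planar y)^-1.
have w0 : 0 < modulus w.
  rewrite modulus_gt0 invr_eq0; apply: Re_neq0_neq0; rewrite -normr_gt0.
  by apply: lt_le_trans (Re_planar_far planar_dist Ly ya); lra.
have [F [cF aF apF hF]] :=
  cauchy_transform_pole compactJ hausdorffJ coded planar_dist a w0.
have Fy : F y != 0.
  apply/negP => /eqP Fy; have := hF y Ly ya.
  by rewrite Fy sub0r modulusN ltxx.
have [cG aG] := cantor_algebra_planar_shift (planar x) cF aF apF.
exists (fun z => (planar z - planar x) * F z); first by split=> //; exists (- 1).
rewrite subrr mul0r eq_sym mulf_neq0 // subr_eq0.
by apply: contra_neq xy => /(planar_inj coded planar_dist Ly Lx).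
Qed.

Lemma cantor_algebra_uniform : is_uniform_algebra A.
Proof.
split.
- by move=> F [].
- exact: cantor_algebra_cst.
- exact: cantor_algebraD.
- by move=> c F AF; apply: (cantor_algebraM compactJ coded (cantor_algebra_cst L sigma c) AF).
- exact: cantor_algebraM.
- move=> F /uclosureP h; have cF : continuous F.
    by apply: continuous_uniform_limit => e /h[G [cG _] hG]; exists G.
  split=> //; apply: (approximable_limit compactJ coded) => // e /h[G [cG [c aG]] hG].
  by exists G, c; split.
- exact: cantor_algebra_separates.
Qed.

(** The value at infinity is a character whose values are all taken on [L]. At [x] in [L]
    it differs from the evaluation on [planar - planar x] times a Cauchy transform, which
    is 0 at [x] and -1 at infinity; at other points, on a function vanishing on [L]. *)
Lemma cantor_algebra_rational_hull :
  has_nontrivial_A_rational_hull (range (point_eval A)).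
Proof.
have uaA := cantor_algebra_uniform.
have /choice[phi hphi] : forall f : A, exists c, approximable (\val f) c.
  by move=> f; have [_] := element_prop f.
have cts (f : A) : continuous (\val f) by have [] := element_prop f.
have phiE (f : A) c : approximable (\val f) c -> phi f = c.
  by move=> h; exact: (approximable_unique compactJ coded (cts f)).
have phiA : max_ideal_space A phi.
  split.
  - exists (element (ua_const uaA 1)).
    rewrite (phiE _ 1) ?oner_neq0 //; exact: approximable_cst.
  - move=> f g h e; apply: phiE; rewrite e.
    exact: (approximableD (hphi f) (hphi g)).
  - move=> c f h e; apply: phiE; rewrite e.
    exact: (approximableZ c (hphi f)).
  - move=> f g h e; apply: phiE; rewrite e.
    exact: (approximableM compactJ coded (cts f) (cts g) (hphi f) (hphi g)).
split.
  move=> _ [x _ <-]; split; first exact: point_eval_character.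
  by move=> f; exists (point_eval A x) => //; exists x.
move=> sub; have : range (point_eval A) phi.
  apply: sub; split=> // f.
  have [x Lx fx] := approximable_value compactJ coded (cts f) (hphi f).
  by exists (point_eval A x) => //; exists x.
move=> [x _ phix].
have phi_eval F c (AF : A F) : approximable F c -> F x = c.
  by move=> aF; rewrite -(phiE (element AF) c aF) -phix.
have [Lx|Lx] := pselect (L x).
  have [F [cF aF apF _]] :=
    cauchy_transform_pole compactJ hausdorffJ coded planar_dist true ltr01.
  have [cG aG] := cantor_algebra_planar_shift (planar x) cF aF apF.
  have /phi_eval : A (fun z => (planar z - planar x) * F z) by split=> //; exists (- 1).
  move=> /(_ _ aG); rewrite subrr mul0r => /eqP.
  by rewrite eq_sym oppr_eq0 oner_eq0.
have [y Ly _] := coding_onto coded [::].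
have xy : x != y by apply: contra_notN Lx => /eqP ->.
have [|u [cu _ u0 u1]] := @urysohn_function R J compactJ hausdorffJ
    L [set x] (closed_coded coded) (@closed_point x).
  by apply/seteqP; split=> // z [Lz /= zx]; apply: Lx; rewrite -zx.
have a0 : approximable (fun z => ((u z)%:C)%C) 0.
  by apply: approximable_eq (approximable_cst L sigma (0 : C)) => z Lz; rewrite u0.
have /phi_eval : A (fun z => ((u z)%:C)%C).
  by split; [exact: continuous_real_complex|exists 0].
move=> /(_ _ a0); rewrite u1 // => /eqP.
by rewrite -(rmorph0 (real_complex R)) (inj_eq (@complexI R)) oner_eq0.
Qed.

(** An approximation on half of the Cantor set is corrected on the rest of [K] by a
    function vanishing on [L], hence in the algebra. *)
Lemma cantor_algebra_dense (i : bool) (K : set J) : closed K ->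
  K `&` L = L `&` [set x | sigma x 0%N = i] ->
  forall (g : J -> C) (e : R), continuous g -> 0 < e ->
  exists2 F, A F & forall x, K x -> modulus (F x - g x) < e.
Proof.
move=> cK KL g e cg e0; have e2 : 0 < e / 2 by rewrite divr_gt0.
have [F0 AF0 hF0] := half_closure_continuous compactJ hausdorffJ coded
  planar_dist i cg e2.
have [cF0 _] := AF0.
pose d x := g x - F0 x.
have cd : continuous d := continuousDc cg (continuousNc cF0).
have cB : closed (K `&` [set x | e / 2 <= modulus (d x)]).
  apply: closedI => //.
  have -> : [set x | e / 2 <= modulus (d x)] = (fun x => modulus (d x)) @^-1` [set r | e / 2 <= r].
    by [].
  apply: closed_comp; last exact: closed_ge.
  by move=> x _; exact: continuous_modulus.
have [|u [cu u01 u0 u1]] := @urysohn_function R J compactJ hausdorffJ L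
    (K `&` [set x | e / 2 <= modulus (d x)]) (closed_coded coded) cB.
  apply/seteqP; split=> // x [Lx [Kx /=]]; rewrite leNgt => /negP; apply.
  rewrite /d modulusB; apply: hF0.
  by have : (K `&` L) x by []; rewrite KL.
exists (fun x => F0 x + ((u x)%:C)%C * d x).
  apply: (cantor_algebra_off_L AF0).
    exact: (continuousDc cF0 (continuousMc (continuous_real_complex cu) cd)).
  by move=> x Lx; rewrite u0 // mul0r addr0.
move=> x Kx; have -> : F0 x + ((u x)%:C)%C * d x - g x = (((u x - 1)%:C)%C : C) * d x.
  by rewrite rmorphB rmorph1 /d; ring.
rewrite modulusM modulus_real; have /andP[ux0 ux1] := u01 x.
have [h|h] := leP (e / 2) (modulus (d x)).
  by rewrite u1 // subrr normr0 mul0r.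
apply: (@le_lt_trans _ _ (1 * modulus (d x))); last by move: h e0; lra.
by rewrite ler_wpM2r // ler_norml; apply/andP; split; lra.
Qed.

End algebra_properties.

(** * Digits on the middle-thirds Cantor set *)

Section thirds.
Variable R : realType.
Local Notation T := (@middle_thirds_cantor_set R).
Local Notation stage n := (iter n (@remove_middle_third R) `[0, 1]%classic).

Definition third_shift (x : R) : R := if x < 1 / 2 then 3 * x else 3 * x - 2.
Definition third_digit (k : nat) (x : R) : bool := ~~ (iter k third_shift x < 1 / 2).

Lemma third_digitS k x : third_digit k.+1 x = third_digit k (third_shift x).
Proof. by rewrite /third_digit iterSr. Qed.

Lemma stage_sub n x : stage n x -> 0 <= x <= 1.
Proof.
elim: n x => [|n IH] x /=; first by rewrite in_itv.
by move=> [[y /IH/andP[h1 h2] <-]|[y /IH/andP[h1 h2] <-]]; apply/andP; split; lra.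
Qed.

Lemma thirds_shift x : T x -> T (third_shift x) /\
  (if third_digit 0 x then 2 / 3 <= x <= 1 else 0 <= x <= 1 / 3).
Proof.
move=> Tx; have h n : stage n (third_shift x) /\
    (if third_digit 0 x then 2 / 3 <= x <= 1 else 0 <= x <= 1 / 3).
  have := Tx n.+1 I; rewrite /third_shift /third_digit /=.
  move=> [[y Sy <-]|[y Sy <-]]; have /andP[h1 h2] := stage_sub Sy.
    have -> : y / 3 < 1 / 2 by lra.
    have -> : 3 * (y / 3) = y by lra.
    by split=> //; apply/andP; split; lra.
  have -> : ((y + 2) / 3 < 1 / 2) = false by apply/negbTE; rewrite -leNgt; lra.
  have -> : 3 * ((y + 2) / 3) - 2 = y by lra.
  by split=> //; apply/andP; split; lra.
by split; [move=> n _; have [] := h n|have [] := h 0%N].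
Qed.

Lemma thirds_bounds x : T x -> 0 <= x <= 1.
Proof. by move=> /(_ 0%N I)/stage_sub. Qed.

Lemma thirds_cons (b : bool) x : T x ->
  [/\ T ((x + 2 *+ b) / 3), third_digit 0 ((x + 2 *+ b) / 3) = b &
      third_shift ((x + 2 *+ b) / 3) = x].
Proof.
move=> Tx; have /andP[h1 h2] := thirds_bounds Tx.
have lt : ((x + 2 *+ b) / 3 < 1 / 2) = ~~ b.
  by case: b; rewrite ?mulr1n ?mulr0n; 
    [apply/negbTE; rewrite -leNgt; lra|rewrite /=; apply/idP; rewrite addr0; lra].
split.
- case=> [_|n _] /=.
    by rewrite in_itv /=; case: b {lt}; rewrite ?mulr1n ?mulr0n; apply/andP; split; lra.
  by case: b {lt}; [right|left]; exists x; rewrite ?mulr1n ?mulr0n ?addr0 //; exact: Tx.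
- by rewrite /third_digit /= lt negbK.
- by rewrite /third_shift lt; case: b {lt}; rewrite /= ?mulr1n ?mulr0n; lra.
Qed.

Lemma thirds0 : T 0.
Proof.
move=> n _; elim: n => [|n IH] /=; first by rewrite in_itv /= lexx ler01.
by left; exists 0 => //; rewrite mul0r.
Qed.

Lemma thirds_onto (v : seq bool) : exists2 x, T x & mkseq (third_digit^~ x) (size v) = v.
Proof.
elim: v => [|b v [x Tx hx]]; first by exists 0 => //; exact: thirds0.
have [Ty d0 ds] := thirds_cons b Tx; exists ((x + 2 *+ b) / 3) => //.
rewrite /= /mkseq /= d0; congr (_ :: _); rewrite -[in RHS]hx /mkseq (iotaDl 1 0) -map_comp.
by apply: eq_map => k /=; rewrite add1n third_digitS ds.
Qed.

Lemma thirds_inj x y : T x -> T y -> third_digit^~ x =1 third_digit^~ y -> x = y.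
Proof.
move=> Tx Ty h.
have key n : forall u w, T u -> T w -> third_digit^~ u =1 third_digit^~ w ->
    `|u - w| <= (1 / 3) ^+ n.
  elim: n => [|n IH] u w Tu Tw huw.
    have := thirds_bounds Tu; have := thirds_bounds Tw => /andP[a b] /andP[c d].
    by rewrite expr0 ler_norml; apply/andP; split; lra.
  have [Tu' _] := thirds_shift Tu; have [Tw' _] := thirds_shift Tw.
  have := IH _ _ Tu' Tw' (fun k => etrans (esym (third_digitS k u))
    (etrans (huw k.+1) (third_digitS k w))).
  have := huw 0%N; rewrite /third_digit /= => /negb_inj lt.
  have -> : third_shift u - third_shift w = 3 * (u - w).
    by rewrite /third_shift lt; case: ifP => _; ring.
  by rewrite normrM ger0_norm // exprS; lra.
apply/eqP; rewrite -subr_eq0 -normr_le0 leNgt; apply/negP => xy.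
have [|n hn] := @exp_small R (1 / 3) `|x - y| _ xy; first by apply/andP; split; lra.
by have := key n x y Tx Ty h; rewrite leNgt hn.
Qed.

Lemma closed_scaled (B : set R) (c d : R) : closed B -> closed [set x | B (c * x + d)].
Proof.
move=> cB; apply: (@closed_comp _ _ (fun x : R => c * x + d)) => // x _.
by apply: cvgD; [apply: cvgM; [exact: cvg_cst|exact: cvg_id]|exact: cvg_cst].
Qed.

Lemma closed_thirds : closed T.
Proof.
apply: closed_bigI => n _; elim: n => [|n IH] /=; first exact: itv_closed.
have -> : remove_middle_third (stage n) =
    [set x | stage n (3 * x + 0)] `|` [set x | stage n (3 * x + (- 2))].
  apply/seteqP; split=> x /=.
    move=> [[y Sy <-]|[y Sy <-]]; [left|right].
      by have -> : 3 * (y / 3) + 0 = y by lra.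
    by have -> : 3 * ((y + 2) / 3) + (- 2) = y by lra.
  move=> [h|h]; [left|right].
    by exists (3 * x + 0) => //; lra.
  by exists (3 * x + (- 2)) => //; lra.
by apply: closedU; exact: closed_scaled.
Qed.

Lemma thirds_digit_cases x : T x ->
  (third_digit 0 x = false /\ x <= 1 / 3 /\ third_shift x = 3 * x + 0) \/
  (third_digit 0 x = true /\ 2 / 3 <= x /\ third_shift x = 3 * x + (- 2)).
Proof.
move=> Tx; have [_] := thirds_shift Tx; rewrite /third_digit /third_shift /=.
case: ifP => h /andP[h1 h2]; [right|left]; rewrite ?h /=.
  by rewrite (negbTE h).
by move/negbFE : h => ->; rewrite addr0.
Qed.

(** The two thirds being apart, the first digit is locally constant, so that the shift
    is continuous on the Cantor set. *)
Lemma closed_third_digit k b : closed (T `&` [set x | third_digit k x = b]).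
Proof.
elim: k => [|k IH].
  have -> : T `&` [set x | third_digit 0 x = b] =
      T `&` (if b then [set x | 2 / 3 <= x] else [set x | x <= 1 / 3]).
    apply/seteqP; split=> x [Tx h]; split=> //;
      case: (thirds_digit_cases Tx) => [[d0 [h1 _]]|[d0 [h1 _]]]; move: h; rewrite /= d0.
    - by move=> <-.
    - by move=> <-.
    - by case: b => //= h2; have : (0 : R) < 0; [lra|rewrite ltxx].
    - by case: b => //= h2; have : (0 : R) < 0; [lra|rewrite ltxx].
  apply: closedI; first exact: closed_thirds.
  by case: b; [exact: closed_ge|exact: closed_le].
pose B := T `&` [set x | third_digit k x = b].
have -> : T `&` [set x | third_digit k.+1 x = b] =
    T `&` (([set x | x <= 1 / 3] `&` [set x | B (3 * x + 0)]) `|`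
           ([set x | 2 / 3 <= x] `&` [set x | B (3 * x + (- 2))])).
  apply/seteqP; split=> x [Tx h]; split=> //; have [Ts _] := thirds_shift Tx.
    move: h; rewrite /= third_digitS => h.
    case: (thirds_digit_cases Tx) => [[_ [h1 e]]|[_ [h1 e]]]; [left|right];
      by split=> //; rewrite /B /= -e.
  move: h => /= h; rewrite third_digitS.
  case: (thirds_digit_cases Tx) => [[_ [h1 e]]|[_ [h1 e]]]; move: h => [[h2 [_ h]]|[h2 [_ h]]];
    rewrite e //; (have : (0 : R) < 0; [move: h1 h2 => /=; lra|by rewrite ltxx]).
apply: closedI; first exact: closed_thirds.
by apply: closedU; apply: closedI; [exact: closed_le| |exact: closed_ge|]; exact: closed_scaled.
Qed.

Lemma compact_third_digit k b : compact (T `&` [set x | third_digit k x = b]).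
Proof.
apply: (subclosed_compact (closed_third_digit (b := b))); first exact: (@segment_compact R 0 1).
by move=> x [/thirds_bounds h _]; rewrite /= in_itv.
Qed.

End thirds.

(** The cells are images of compact sets of reals under the homeomorphism. *)
Lemma cantor_set_coding (R : realType) (J : topologicalType) (S : set J) :
  hausdorff_space J -> is_cantor_set R S -> exists sigma, coding S sigma.
Proof.
move=> hJ [f [g [cf cg fK gK]]]; pose T := @middle_thirds_cantor_set R.
pose sigma x k := if pselect (S x) is left Sx then
  third_digit k (\val (f (exist _ x (mem_set Sx)))) else false.
have sigmaE (x : S) k : sigma (\val x) k = third_digit k (\val (f x)).
  rewrite /sigma; case: pselect => [Sx|[]]; last exact: set_mem (valP x).
  by congr (third_digit k (\val (f _))); apply: val_inj.
pose t0 : T := exist _ 0 (mem_set (@thirds0 R)).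
pose G (r : R) : J := if pselect (T r) is left Tr then \val (g (exist _ r (mem_set Tr)))
  else \val (g t0).
have GE (t : T) : G (\val t) = \val (g t).
  rewrite /G; case: pselect => [Tr|[]]; last exact: set_mem (valP t).
  by congr (\val (g _)); apply: val_inj.
have cG : {within T, continuous G}.
  apply/subspace_sigL_continuousP.
  have -> : sigL T G = \val \o g by apply/funext => t; exact: GE.
  by move=> t; apply: continuous_comp; [exact: cg|exact: initial_continuous].
exists sigma; split.
- move=> k b; apply: compact_closed => //.
  have -> : S `&` [set x | sigma x k = b] = G @` (T `&` [set r | third_digit k r = b]).
    apply/seteqP; split=> [x [Sx /= xb]|_ [r [Tr /= rb] <-]].
      pose x' : S := exist _ x (mem_set Sx).
      exists (\val (f x')); last by rewrite GE fK.
      by split; [exact: set_mem (valP (f x'))|rewrite /= -sigmaE].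
    pose r' : T := exist _ r (mem_set Tr); rewrite -[r]/(\val r') GE.
    by split; [exact: set_mem (valP (g r'))|rewrite /= sigmaE gK].
  apply: continuous_compact; last exact: compact_third_digit.
  by apply: continuous_subspaceW cG; exact: subIsetl.
- move=> x y Sx Sy h; pose x' : S := exist _ x (mem_set Sx).
  pose y' : S := exist _ y (mem_set Sy).
  suff : f x' = f y' by move=> /(can_inj fK) /(congr1 \val).
  apply: val_inj; apply: thirds_inj; try exact: set_mem (valP _).
  by move=> k; rewrite -!sigmaE; exact: h.
- move=> v; have [r Tr hr] := thirds_onto R v.
  pose r' : T := exist _ r (mem_set Tr).
  exists (\val (g r')); first exact: set_mem (valP (g r')).
  by rewrite -[RHS]hr; apply: eq_map => k; rewrite sigmaE gK.
Qed.

(** Prefixing the digits with the number of the set makes the two given Cantor sets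
    correspond to the two halves of the planar one. *)
Lemma union_coding (J : topologicalType) (S0 S1 : set J) s0 s1 :
  S0 `&` S1 = set0 -> coding S0 s0 -> coding S1 s1 ->
  exists2 sigma, coding (S0 `|` S1) sigma &
    S0 = (S0 `|` S1) `&` [set x | sigma x 0%N = false] /\
    S1 = (S0 `|` S1) `&` [set x | sigma x 0%N = true].
Proof.
move=> S01 c0 c1.
pose sigma x k := if k is k'.+1 then
  (if `[< S1 x >] then s1 x k' else s0 x k') else `[< S1 x >].
have n0 x : S0 x -> `[< S1 x >] = false.
  by move=> S0x; apply/negbTE/asboolPn => S1x; have : (S0 `&` S1) x by []; rewrite S01.
have n1 x : S1 x -> `[< S1 x >] = true by move=> h; exact/asboolP.
have e0 : S0 = (S0 `|` S1) `&` [set x | sigma x 0%N = false].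
  apply/seteqP; split=> [x h|x [[]//h /=]]; first by split; [left|exact: n0].
  by rewrite n1.
have e1 : S1 = (S0 `|` S1) `&` [set x | sigma x 0%N = true].
  apply/seteqP; split=> [x h|x [[]//h /=]]; first by split; [right|exact: n1].
  by rewrite n0.
exists sigma; last by split.
split.
- case=> [|k] b.
    by case: b; [rewrite -e1; exact: closed_coded c1|rewrite -e0; exact: closed_coded c0].
  have -> : (S0 `|` S1) `&` [set x | sigma x k.+1 = b] =
      (S0 `&` [set x | s0 x k = b]) `|` (S1 `&` [set x | s1 x k = b]).
    apply/seteqP; split=> x /=.
      by move=> [[h|h]]; rewrite ?(n0 _ h) ?(n1 _ h); [left|right].
    by move=> [[h <-]|[h <-]]; split; rewrite ?(n0 _ h) ?(n1 _ h) //; [left|right].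
  by apply: closedU; [exact: coding_closed c0 _ _|exact: coding_closed c1 _ _].
- move=> x y hx hy h; have := h 0%N => /=.
  have hS k := h k.+1; rewrite /sigma in hS.
  case: hx hy => [hx|hx] [hy|hy]; move: hS;
    rewrite ?(n0 _ hx) ?(n1 _ hx) ?(n0 _ hy) ?(n1 _ hy) // => hS _.
    exact: (coding_inj c0).
  exact: (coding_inj c1).
- case=> [|b v]; first by have [x Sx _] := coding_onto c0 [::]; exists x => //; left.
  case: b.
    have [x Sx hx] := coding_onto c1 v; exists x; first by right.
    rewrite /mkseq /= n1 //; congr (_ :: _); rewrite -[in RHS]hx /mkseq (iotaDl 1 0) -map_comp.
    by apply: eq_map => k /=; rewrite n1.
  have [x Sx hx] := coding_onto c0 v; exists x; first by left.
  rewrite /mkseq /= n0 //; congr (_ :: _); rewrite -[in RHS]hx /mkseq (iotaDl 1 0) -map_comp.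
  by apply: eq_map => k /=; rewrite n0.
Qed.

(** * The theorem *)

Theorem theorem3p13 (R : realType) (J : topologicalType) (K1 K2 : set J)
    (compactJ : compact [set: J]) (hausdorffJ : hausdorff_space J)
    (closedK1 : closed K1) (closedK2 : closed K2)
    (coverJ : K1 `|` K2 = [set: J])
    (cantor1 : contains_cantor_set R (~` K1))
    (cantor2 : contains_cantor_set R (~` K2)) :
  exists A : set (J -> Cplx R),
    [/\ is_uniform_algebra A,
        has_nontrivial_A_rational_hull (range (point_eval A)),
        A_convex (point_eval A @` K1) /\
          uclosure (restriction_algebra A K1) = continuous_functions R K1 &
        A_convex (point_eval A @` K2) /\
          uclosure (restriction_algebra A K2) = continuous_functions R K2].
Proof.
have [S1 [S1K /(cantor_set_coding hausdorffJ)[s1 c1]]] := cantor1.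
have [S2 [S2K /(cantor_set_coding hausdorffJ)[s2 c2]]] := cantor2.
have cover x : K1 x \/ K2 x by have : [set: J] x by []; rewrite -coverJ.
have S12 : S1 `&` S2 = set0.
  apply/seteqP; split=> // x [/S1K h1 /S2K h2].
  by case: (cover x).
have [sigma coded [e1 e2]] := union_coding S12 c1 c2.
have [planar cpl hpl] := exists_planar_map R compactJ hausdorffJ coded.
have uaA := cantor_algebra_uniform compactJ hausdorffJ coded cpl hpl.
have K1L : K1 `&` (S1 `|` S2) = (S1 `|` S2) `&` [set x | sigma x 0%N = true].
  rewrite -e2; apply/seteqP; split=> x.
    by move=> [Kx [/S1K|]].
  by move=> S2x; split; [case: (cover x) => // /(S2K _ S2x)|right].
have K2L : K2 `&` (S1 `|` S2) = (S1 `|` S2) `&` [set x | sigma x 0%N = false].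
  rewrite -e1; apply/seteqP; split=> x.
    by move=> [Kx [|/S2K]].
  by move=> S1x; split; [case: (cover x) => // /(S1K _ S1x)|left].
have d1 := cantor_algebra_dense compactJ hausdorffJ coded hpl closedK1 K1L.
have d2 := cantor_algebra_dense compactJ hausdorffJ coded hpl closedK2 K2L.
exists (@cantor_algebra R J (S1 `|` S2) sigma); split=> //.
- exact (cantor_algebra_rational_hull compactJ hausdorffJ coded cpl hpl).
- by split; [exact: dense_restriction_A_convex|exact: dense_restriction_uclosure].
- by split; [exact: dense_restriction_A_convex|exact: dense_restriction_uclosure].
Qed.
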